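(* Let $x^{(0)}\in\mathcal{X}$, $u_1^{(0)}\in\mathcal{U}_1,\ldots,u_M^{(0)}\in\mathcal{U}_M$. Let $\tau>0$ and $\sigma_1>0,\ldots,\sigma_M>0$ be such that $\tau\Big(\big\|\sum_{m=1}^M\sigma_mL_m^*L_m\big\|+\frac{\beta}{2}\Big)<1$. Set $\delta=2-\frac{\beta}{2}\Big(\frac1\tau-\big\|\sum_{m=1}^M\sigma_mL_m^*L_m\big\|\Big)^{-1}>1$. Let $(\rho^{(i)})_{i\in\mathbb{N}}$ be a sequence in $[0,\delta]$ such that $\sum_{i\in\mathbb{N}}\rho^{(i)}(\delta-\rho^{(i)})=+\infty$. Let the sequences be defined, for $i=0,1,\ldots$ and $m=1,\ldots,M$, either by (form I) $$\begin{aligned}x^{(i+\frac12)}&=\mathrm{prox}_{\tau f}\Big(x^{(i)}-\tau\nabla h(x^{(i)})-\tau\sum_{m=1}^ML_m^*u_m^{(i)}\Big),\\ u_m^{(i+\frac12)}&=\mathrm{prox}_{\sigma_mg_m^*}\big(u_m^{(i)}+\sigma_mL_m(2x^{(i+\frac12)}-x^{(i)})\big),\end{aligned}$$ or by (form II) $$\begin{aligned}u_m^{(i+\frac12)}&=\mathrm{prox}_{\sigma_mg_m^*}\big(u_m^{(i)}+\sigma_mL_mx^{(i)}\big),\\ x^{(i+\frac12)}&=\mathrm{prox}_{\tau f}\Big(x^{(i)}-\tau\nabla h(x^{(i)})-\tau\sum_{m=1}^ML_m^*\big(2u_m^{(i+\frac12)}-u_m^{(i)}\big)\Big),\end{aligned}$$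 followed in both cases by $$x^{(i+1)}=x^{(i)}+\rho^{(i)}(x^{(i+\frac12)}-x^{(i)}),\qquad u_m^{(i+1)}=u_m^{(i)}+\rho^{(i)}(u_m^{(i+\frac12)}-u_m^{(i)}).$$ Then, in either case, $(x^{(i)})_{i\in\mathbb{N}}$ converges weakly to a solution of the primal problem of minimizing $f(x)+\sum_{m=1}^Mg_m(L_mx)+h(x)$ over $x\in\mathcal{X}$, and $\big((u_1^{(i)},\ldots,u_M^{(i)})\big)_{i\in\mathbb{N}}$ converges weakly to a solution of the dual problem of minimizing $(f+h)^*\big(-\sum_{m=1}^ML_m^*u_m\big)+\sum_{m=1}^Mg_m^*(u_m)$ over $(u_1,\ldots,u_M)\in\mathcal{U}_1\times\cdots\times\mathcal{U}_M$.
   Context: $M\ge1$ is an integer; $\mathcal{X}$ and $\mathcal{U}_1,\ldots,\mathcal{U}_M$ are real Hilbert spaces. For a real Hilbert space $\mathcal{H}$, $\Gamma_0(\mathcal{H})$ is the set of convex, proper, lower semicontinuous functions from $\mathcal{H}$ to $\mathbb{R}\cup\{+\infty\}$; for $\varphi\in\Gamma_0(\mathcal{H})$, $\varphi^*(y)=\sup_{x\in\mathcal{H}}(\langle x,y\rangle-\varphi(x))$ is its conjugate, $\partial\varphi$ its subdifferential, and $\mathrm{prox}_{\varphi}(x)=\operatorname{arg\,min}_{x'\in\mathcal{H}}(\varphi(x')+\frac12\|x'-x\|^2)$. Here $f\in\Gamma_0(\mathcal{X})$, $g_m\in\Gamma_0(\mathcal{U}_m)$ and $L_m:\mathcal{X}\to\mathcal{U}_m$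 is a bounded linear operator with adjoint $L_m^*$, for $m=1,\ldots,M$; $h:\mathcal{X}\to\mathbb{R}$ is convex and differentiable with $\beta$-Lipschitz continuous gradient for some real $\beta>0$. Standing assumption: there exists $x\in\mathcal{X}$ with $0\in\partial f(x)+\sum_{m=1}^ML_m^*\partial g_m(L_mx)+\nabla h(x)$. *)

(* Defs.v *)
From HB Require Import structures.
From mathcomp Require Import all_boot all_order all_algebra.
From mathcomp Require Import sesquilinear.
From mathcomp Require Import all_classical all_reals all_analysis.

Set Implicit Arguments.
Unset Strict Implicit.
Unset Printing Implicit Defensive.

Import Order.TTheory GRing.Theory Num.Theory.
Import numFieldNormedType.Exports.

Local Open Scope classical_set_scope.
Local Open Scope ring_scope.

HB.mixin Record CompleteNormedModule_isHilbert (R : realType) H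
    of CompleteNormedModule R H := {
  inner : {dot H for @idfun R};
  inner_norm : forall x : H, inner x x = `|x| ^+ 2
}.

#[short(type="hilbertType")]
HB.structure Definition Hilbert (R : realType) :=
  {H of CompleteNormedModule R H & CompleteNormedModule_isHilbert R H}.

Section Operators.
Context {R : realType}.

(* By the Riesz theorem the set is a singleton when A is bounded linear. *)
Definition adjoint {H K : hilbertType R} (A : H -> K) (u : K) : H :=
  xget 0 [set x | forall y, inner (A y) u = inner y x].

(* The supremum is taken in R: it is the operator norm when A is bounded
   linear. *)
Definition opnorm {H K : normedModType R} (A : H -> K) : R :=
  sup [set `|A x| | x in [set x | `|x| <= 1]].

(* By the Riesz theorem the set is a singleton when h is differentiable at x. *)
Definition gradient {H : hilbertType R} (h : H -> R^o) (x : H) : H :=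
  xget 0 [set g | forall v, 'd h x v = inner v g].

Definition weakly_cvg {T : Type} (ip : T -> T -> R) (s : nat -> T) (l : T) :=
  forall v, ip (s i) v @[i --> \oo] --> ip l v.

(* The inner product of the Hilbert direct sum of the U m. *)
Definition sum_inner {M : nat} {U : 'I_M -> hilbertType R}
    (u v : forall m, U m) : R :=
  \sum_(m < M) inner (u m) (v m).

End Operators.

Section ConvexAnalysis.
Context {R : realType}.
Local Open Scope ereal_scope.

Definition argmin {T : Type} (F : T -> \bar R) : set T :=
  [set x | forall y, F x <= F y].

(* With the convention 0 * +oo = 0 of \bar R, the endpoints t = 0 and t = 1
   are harmless for functions that do not take the value -oo. *)
Definition convex_ereal {H : lmodType R} (phi : H -> \bar R) :=
  forall (x y : H) (t : R), (0 <= t <= 1)%R ->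
    phi (t *: x + (1 - t) *: y)%R <= t%:E * phi x + (1 - t)%:E * phi y.

Definition proper {T : Type} (phi : T -> \bar R) :=
  (forall x, phi x != -oo) /\ (exists x, phi x != +oo).

Definition Gamma0 {H : hilbertType R} (phi : H -> \bar R) :=
  [/\ convex_ereal phi, proper phi & lower_semicontinuous phi].

Definition conjugate {H : hilbertType R} (phi : H -> \bar R) (y : H) : \bar R :=
  ereal_sup (range (fun x => (inner x y)%:E - phi x)).

Definition subdifferential {H : hilbertType R} (phi : H -> \bar R) (x : H) :
    set H :=
  [set u | forall y, phi x + (inner (y - x)%R u)%:E <= phi y].

(* The minimizer exists and is unique when phi is in Gamma0. *)
Definition prox {H : hilbertType R} (phi : H -> \bar R) (x : H) : H :=
  xget 0%R (argmin (fun y => phi y + (2^-1 * `|y - x| ^+ 2)%:E)).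

End ConvexAnalysis.

(* Main.v *)
Require Import Defs.
From HB Require Import structures.
From mathcomp Require Import all_boot all_order all_algebra.
From mathcomp Require Import all_classical all_reals all_analysis.
From mathcomp Require Import sesquilinear ring lra.
Set Implicit Arguments.
Unset Strict Implicit.
Unset Printing Implicit Defensive.
Import Order.TTheory GRing.Theory Num.Theory.
Import numFieldNormedType.Exports.
Local Open Scope classical_set_scope.
Local Open Scope ring_scope.

(** Write z = (x, u_1, ..., u_M), let T map an iterate to its half step, and let
    Q = id - T, so that z^(i+1) = z^(i) - rho^(i) Q z^(i). The optimality
    conditions of the proximity operators turn the half step into
    P (z - T z) \in C z + S (T z), where C z = (grad h(x), 0),
    S (x, u) = (A x + sum_m L_m^* u_m, B^-1 u - L x) is monotone (A and B_m are
    the subdifferentials of f and g_m) and P is the operator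
      P (x, u) = (x / tau + eps sum_m L_m^* u_m, u_m / sigma_m + eps L_m x),
    with eps = -1 in form I and eps = 1 in form II. This sign is the only
    difference between the two forms ([form1_step], [form2_step]).

    Completing the square in u shows that the quadratic form of P dominates
    (1 / tau - normL) |x|^2 ([pd_form_ge]); the step size condition makes this
    coefficient larger than beta / 2, so P defines an inner product. The gradient
    of h is 1/beta-cocoercive ([baillon_haddad]). Together with the
    monotonicity of S this makes Q cocoercive for P with constant delta / 2
    ([pd_residual_cocoercive]), that is, T is 1/delta-averaged.

    The convergence is then that of relaxed Krasnoselskii-Mann iterations
    ([krasnoselskii_mann]). Distances to zeros of Q decrease, the residual
    |Q z^(i)| decreases too and, the series of rho (delta - rho) being divergent,
    it tends to 0. A weak cluster point is a zero of Q by cocoercivity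
    ([demiclosed]), and two cluster points coincide by Opial's argument
    ([weak_cluster_unique]). Cluster points are taken along ultrafilters: along an
    ultrafilter every bounded real sequence converges, so a bounded sequence of a
    Hilbert space has a weak limit by the Riesz theorem.

    The zeros of Q are the solutions (x, u) of the inclusions
    0 \in A x + sum_m L_m^* u_m + grad h(x) and u_m \in B_m (L_m x); adding
    subgradient inequalities, respectively Fenchel-Young inequalities, shows that
    such x and u minimize the primal and the dual objective
    ([kkt_argmin_primal], [kkt_argmin_dual]).

    Minimizers of f + |. - w|^2 / 2 are limits of minimizing sequences
    ([argmin_prox_exists]). This lemma serves three times: for the proximity
    operator of f, for that of g_m^* through Moreau's decomposition, and for the
    Riesz theorem, where f is minus a linear functional. *)

(** * Inner products *)

Section InnerProduct.
Context {R : realType} {H : hilbertType R}.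
Implicit Types (x y z : H) (a : R).

Lemma innerC x y : inner x y = inner y x.
Proof. by rewrite (hermitian_subproof (s := inner)) expr0 mul1r. Qed.

Lemma innerDl x y z : inner (x + y) z = inner x z + inner y z.
Proof. exact: linearDl. Qed.

Lemma innerDr x y z : inner z (x + y) = inner z x + inner z y.
Proof. by rewrite innerC innerDl !(innerC z). Qed.

Lemma innerZl a x z : inner (a *: x) z = a * inner x z.
Proof. exact: linearZl_LR. Qed.

Lemma innerZr a x z : inner z (a *: x) = a * inner z x.
Proof. by rewrite innerC innerZl (innerC z). Qed.

Lemma innerNl x z : inner (- x) z = - inner x z.
Proof. by rewrite -scaleN1r innerZl mulN1r. Qed.

Lemma innerNr x z : inner z (- x) = - inner z x.
Proof. by rewrite -scaleN1r innerZr mulN1r. Qed.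

Lemma inner0l z : inner 0 z = 0.
Proof. by rewrite -(scale0r 0) innerZl mul0r. Qed.

Lemma inner0r z : inner z 0 = 0.
Proof. by rewrite innerC inner0l. Qed.

Lemma inner_sumr (I : Type) (s : seq I) (P : pred I) (F : I -> H) z :
  inner z (\sum_(i <- s | P i) F i) = \sum_(i <- s | P i) inner z (F i).
Proof.
by elim/big_rec2 : _ => [|i a b _ <-]; rewrite ?inner0r// innerDr.
Qed.

Definition innerE := (innerDl, innerDr, innerZl, innerZr, innerNl, innerNr).

Lemma inner_ge0 x : 0 <= inner x x.
Proof. by rewrite inner_norm exprn_ge0. Qed.

Lemma inner_eq0 x : inner x x = 0 -> x = 0.
Proof. by move/eqP; rewrite inner_norm expf_eq0/= normr_eq0 => /eqP. Qed.

Lemma inner_inj x y : (forall z, inner z x = inner z y) -> x = y.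
Proof.
move=> xy; apply/eqP; rewrite -subr_eq0; apply/eqP/inner_eq0.
by rewrite innerDr innerNr xy subrr.
Qed.

Lemma inner_le_norm x y : inner x y <= `|x| * `|y|.
Proof.
have [->|x0] := eqVneq x 0; first by rewrite inner0l normr0 mul0r.
have [->|y0] := eqVneq y 0; first by rewrite inner0r normr0 mulr0.
have xy : 0 < `|x| * `|y| by rewrite mulr_gt0 ?normr_gt0.
have := inner_ge0 (`|y| *: x - `|x| *: y).
rewrite !innerE (innerC y x) !inner_norm.
rewrite [X in 0 <= X](_ : _ =
  2 * (`|x| * `|y|) * (`|x| * `|y| - inner x y)); last by ring.
by rewrite pmulr_rge0 ?subr_ge0// mulr_gt0.
Qed.

Lemma abs_inner_le x y : `|inner x y| <= `|x| * `|y|.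
Proof.
rewrite ler_norml inner_le_norm andbT.
by have := inner_le_norm (- x) y; rewrite innerNl normrN; lra.
Qed.

End InnerProduct.

(** * Proximity operators and conjugates *)

Section ProximityOperator.
Context {R : realType} {H : hilbertType R}.
Implicit Types (F : H -> \bar R) (x y w u v p : H).

(** Replaces a passage to the limit t -> 0 in first-order optimality
    conditions. *)
Lemma le0_of_le_small (A B : R) :
  (forall t, 0 < t <= 1 -> A <= t * B) -> A <= 0.
Proof.
move=> AB; rewrite leNgt; apply/negP => A0.
have B0 : 0 < B by have := AB 1; rewrite ltr01 lexx mul1r => /(_ isT); lra.
have AB1 : A <= B by have := AB 1; rewrite ltr01 lexx mul1r => /(_ isT).
have := AB (A / (2 * B)); rewrite ltr_pdivlMr ?mulr_gt0// ler_pdivrMr ?mulr_gt0//.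
rewrite mul0r A0 mul1r (_ : A / (2 * B) * B = A / 2); last first.
  by field; rewrite gt_eqF.
have AB2 : A <= 2 * B by lra.
by rewrite AB2 => /(_ isT); lra.
Qed.

Lemma sqrnormE x : `|x| ^+ 2 = inner x x.
Proof. by rewrite inner_norm. Qed.

Lemma sqrnormD x y : `|x + y| ^+ 2 = `|x| ^+ 2 + 2 * inner x y + `|y| ^+ 2.
Proof. by rewrite !sqrnormE !innerE (innerC y x); ring. Qed.

Lemma parallelogram x y w :
  `|2^-1 *: (x + y) - w| ^+ 2 =
  2^-1 * (`|x - w| ^+ 2 + `|y - w| ^+ 2) - 4^-1 * `|x - y| ^+ 2.
Proof.
by rewrite !sqrnormE !innerE (innerC y x) (innerC w x) (innerC w y); field.
Qed.

Lemma convex_ereal_real F x y (t a b : R) : convex_ereal F -> 0 <= t <= 1 ->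
  F x = a%:E -> F y = b%:E ->
  (F (t *: x + (1 - t) *: y)%R <= (t * a + (1 - t) * b)%:E)%E.
Proof. by move=> cF t01 Fx Fy; rewrite (le_trans (cF _ _ _ t01))// Fx Fy. Qed.

(** By convexity and the parallelogram identity, two points whose values exceed
    the infimum by e1 and e2 are at squared distance at most 4 (e1 + e2). A
    minimizing sequence is therefore Cauchy, and lower semicontinuity passes to
    the limit. *)
Lemma argmin_prox_exists F w (c : R) : Gamma0 F ->
  (forall y, c%:E <= F y + (2^-1 * `|y - w| ^+ 2)%:E)%E ->
  exists p, argmin (fun y => F y + (2^-1 * `|y - w| ^+ 2)%:E)%E p.
Proof.
move=> [cF [Fnoo [x0 Fx0]] lF] Fc.
pose G y := (F y + (2^-1 * `|y - w| ^+ 2)%:E)%E.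
have [m mE] : exists m : R, ereal_inf (range G) = m%:E.
  have : (c%:E <= ereal_inf (range G))%E.
    by apply: le_ereal_inf_tmp => _ [y _ <-]; exact: Fc.
  have : (ereal_inf (range G) <= G x0)%E by apply: ereal_inf_lbound; exists x0.
  have : (G x0 < +oo)%E by rewrite lte_add_pinfty ?ltry// ltey.
  by case: (ereal_inf _) => [m _ _ _|/le_lt_trans/[apply]|//]; [exists m|].
have mG y : (m%:E <= G y)%E by rewrite -mE; apply: ereal_inf_lbound; exists y.
have /choice[y_ yP] (n : nat) : exists yr : H * R, F yr.1 = yr.2%:E /\
    yr.2 + 2^-1 * `|yr.1 - w| ^+ 2 < m + n.+1%:R^-1.
  have : (ereal_inf (range G) < (m + n.+1%:R^-1)%:E)%E.
    by rewrite mE lte_fin ltrDl invr_gt0.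
  move=> /ereal_inf_lt [_ [y _ <-]]; rewrite /G.
  have := Fnoo y; case Fy : (F y) => [r| |]// _ Gy.
  by exists (y, r).
move=> {mE}; pose s n := (y_ n).1; pose r n := (y_ n).2.
have sr n : F (s n) = (r n)%:E by have [] := yP n.
have rm n : r n + 2^-1 * `|s n - w| ^+ 2 < m + n.+1%:R^-1 by have [] := yP n.
have sC n k : `|s n - s k| ^+ 2 < 4 * (n.+1%:R^-1 + k.+1%:R^-1).
  have t01 : 0 <= (2^-1 : R) <= 1 by lra.
  have := convex_ereal_real cF t01 (sr n) (sr k).
  have -> : 1 - 2^-1 = 2^-1 :> R by field.
  rewrite -(scalerDr _ (s n)) => /(leeD2r (2^-1 * `|2^-1 *: (s n + s k) - w| ^+ 2)%:E).
  move=> /(le_trans (mG _)); rewrite -EFinD lee_fin parallelogram.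
  by have := rm n; have := rm k; move: (n.+1%:R^-1) (k.+1%:R^-1) => en ek; lra.
have cs : cvgn s.
  apply/cauchy_cvgP/cauchy_ballP => e e0.
  have e8 : 0 < e ^+ 2 / 8 by rewrite divr_gt0 ?exprn_gt0.
  have Nn : \forall n \near \oo, (n.+1%:R^-1 : R) < e ^+ 2 / 8.
    exact: near_infty_natSinv_lt (PosNum e8).
  pose A := s @` [set n | (n.+1%:R^-1 : R) < e ^+ 2 / 8].
  exists (A, A) => [|[_ _] [[n /= en <-] [k /= ek <-]]].
    by split; apply: filterS Nn => n en; exists n.
  rewrite -ball_normE /ball_ /=.
  rewrite -(ltr_pXn2r (n:=2)) ?nnegrE// ?(ltW e0)//.
  rewrite (lt_trans (sC n k))//.
  by move: (n.+1%:R^-1) (k.+1%:R^-1) en ek => en ek; lra.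
pose p := lim (s @ \oo).
have sp : s @ \oo --> p by [].
have sw : (2^-1 * `|s n - w| ^+ 2 : R) @[n --> \oo] --> 2^-1 * `|p - w| ^+ 2.
  apply: cvgMl_tmp; rewrite expr2; apply: (@cvgM R nat); apply: cvg_norm;
  by apply: cvgB => //; exact: cvg_cst.
exists p => y; apply: le_trans (mG y).
rewrite leNgt; apply/negP; rewrite -lteBlDr// -EFinB.
set q := 2^-1 * `|p - w| ^+ 2 in sw *.
move=> mFp.
have [a ma aFp] : exists2 a, m - q < a & (a%:E < F p)%E.
  move: mFp; have := Fnoo p; case: (F p) => [b| |]// _.
    rewrite lte_fin => mb; exists ((m - q + b) / 2); rewrite ?lte_fin; lra.
  by exists (m - q + 1); [lra|rewrite ltry].
have [V Vp VF] := lF _ _ aFp.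
have e0 : 0 < (a + q - m) / 2 by lra.
near \oo => n.
have : V (s n) by near: n; exact: sp.
move=> /VF; rewrite sr lte_fin => arn.
have : n.+1%:R^-1 < (a + q - m) / 2.
  by near: n; exact: near_infty_natSinv_lt (PosNum e0).
have : `|q - 2^-1 * `|s n - w| ^+ 2| < (a + q - m) / 2.
  by near: n; exact: cvgr_dist_lt.
by rewrite ltr_norml => /andP[_]; have := rm n; move: (n.+1%:R^-1) => en; lra.
Unshelve. all: by end_near. Qed.

(** Fermat's rule: moving from p by t (y - p) increases the quadratic term by
    t <p - w, y - p> up to O(t^2), and F by at most t (F y - F p). *)
Lemma argmin_prox_subdifferential F w p : Gamma0 F ->
  argmin (fun y => F y + (2^-1 * `|y - w| ^+ 2)%:E)%E p ->
  subdifferential F p (w - p).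
Proof.
move=> [cF [Fnoo [x0 Fx0]] _] pmin.
have [a Fp] : exists a, F p = a%:E.
  have : (F p + (2^-1 * `|p - w| ^+ 2)%:E < +oo)%E.
    by apply: le_lt_trans (pmin x0) _; rewrite lte_add_pinfty ?ltry// ltey.
  by have := Fnoo p; case: (F p) => // a _ _; exists a.
move=> y; rewrite Fp; have := Fnoo y; case Fy : (F y) => [b| |]// _; last first.
  by rewrite leey.
rewrite -EFinD lee_fin -subr_le0.
apply: (@le0_of_le_small _ (2^-1 * `|y - p| ^+ 2)) => t t01.
have t01' : 0 <= t <= 1 by lra.
have := convex_ereal_real cF t01' Fy Fp.
move=> /(leeD2r (2^-1 * `|t *: y + (1 - t) *: p - w| ^+ 2)%:E).
move=> /(le_trans (pmin _)); rewrite Fp -!EFinD lee_fin.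
have -> : t *: y + (1 - t) *: p - w = (p - w) + t *: (y - p).
  by rewrite scalerBl scale1r scalerBr addrCA addrAC.
rewrite (sqrnormD (p - w)) innerZr normrZ exprMn real_normK ?num_real// => le1.
rewrite -(ler_pM2l (_ : 0 < t)); last by lra.
move: le1; rewrite -(opprB w p) innerNl (innerC _ (w - p)); nra.
Qed.

(** The quadratic gap on the left-hand side, due to strong convexity, gives both
    the minimality of p and its uniqueness. *)
Lemma subdifferential_argmin_prox F w p y : subdifferential F p (w - p) ->
  (F p + (2^-1 * `|p - w| ^+ 2)%:E + (2^-1 * `|y - p| ^+ 2)%:E <=
   F y + (2^-1 * `|y - w| ^+ 2)%:E)%E.
Proof.
move=> /(_ y) => /(leeD2r (2^-1 * `|y - w| ^+ 2)%:E).
apply: le_trans; rewrite -!addeA -!EFinD le_eqVlt; apply/orP; left; apply/eqP.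
congr (_ + _%:E)%E.
by rewrite !sqrnormE !innerE (innerC w y) (innerC p y) (innerC w p); field.
Qed.

(** Stated from a subgradient alone, so that it applies directly to the scaled
    conjugates c g^*. *)
Lemma prox_eq F w p : F p \is a fin_num -> subdifferential F p (w - p) ->
  prox F w = p.
Proof.
move=> Fp pw; pose A := argmin (fun y => F y + (2^-1 * `|y - w| ^+ 2)%:E)%E.
have Ap : A p.
  move=> y; apply: le_trans (subdifferential_argmin_prox y pw).
  by rewrite leeDl// lee_fin mulr_ge0// exprn_ge0.
have /(_ p) := xgetPex 0 (ex_intro _ p Ap); rewrite -/(prox F w).
have := subdifferential_argmin_prox (prox F w) pw.
move=> /le_trans/[apply]; rewrite -(fineK Fp) -!EFinD lee_fin => le0.
have : `|prox F w - p| ^+ 2 <= 0 by lra.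
rewrite sqrnormE => le1; apply/eqP; rewrite -subr_eq0; apply/eqP/inner_eq0.
by apply/eqP; rewrite eq_le le1 inner_ge0.
Qed.

Lemma subdifferential_fin_num F x u : Defs.proper F -> subdifferential F x u ->
  F x \is a fin_num.
Proof.
move=> [Fnoo [y0 Fy0]] /(_ y0); rewrite fin_numE Fnoo /=.
by apply: contraTneq => ->; rewrite addye// leye_eq.
Qed.

(** A subgradient at one point provides an affine minorant of F, which bounds
    the proximal objective from below. *)
Lemma prox_subdifferential F w x u : Gamma0 F -> subdifferential F x u ->
  subdifferential F (prox F w) (w - prox F w).
Proof.
move=> GF xu; apply: argmin_prox_subdifferential => //.
have [_ pF _] := GF.
have Fx := subdifferential_fin_num pF xu.
apply: (@xgetPex _ 0 (argmin (fun y => F y + (2^-1 * `|y - w| ^+ 2)%:E)%E)).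
(* Complete the square in the minorant F x + <y - x, u> + |y - w|^2 / 2. *)
apply: (@argmin_prox_exists _ _ (fine (F x) + inner (w - x) u - 2^-1 * `|u| ^+ 2)).
  by [].
move=> y; apply: le_trans (leeD2r _ (xu y)).
rewrite -(fineK Fx) -!EFinD lee_fin.
have : 0 <= `|y - w + u| ^+ 2 by rewrite exprn_ge0.
rewrite !sqrnormE !innerE (innerC u y) (innerC u w) (innerC w y); lra.
Qed.

Lemma Gamma0Z F (c : R) : 0 < c -> Gamma0 F -> Gamma0 (fun x => c%:E * F x)%E.
Proof.
move=> c0 [cF [Fnoo [x0 Fx0]] lF]; split.
- move=> x y t t01.
  rewrite !(muleCA _ c%:E) -muleDr//; first by rewrite lee_pmul2l ?lte_fin// cF.
  have Noo (a : R) z : 0 <= a -> (a%:E * F z != -oo)%E.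
    move=> a0; have := Fnoo z; case: (F z) => // _.
    by rewrite mulry; move: a0; rewrite le0r => /orP[/eqP->|a0];
      rewrite ?sgr0 ?mul0e// gtr0_sg// mul1e.
  by apply: ltninfty_adde_def; rewrite inE ltNye Noo//; lra.
- split=> [x|].
    have := Fnoo x; case: (F x) => [a| |]//= _.
    by rewrite gt0_muley ?lte_fin.
  exists x0; have := Fnoo x0; move: Fx0.
  by case: (F x0) => [a| |].
- move=> x a; rewrite -lte_pdivrMl// -EFinM => /lF[V Vx VF].
  by exists V => // y /VF; rewrite EFinM lte_pdivrMl.
Qed.

Lemma subdifferentialZ F (c : R) x u : 0 < c ->
  subdifferential (fun x => c%:E * F x)%E x u <->
  subdifferential F x (c^-1 *: u).
Proof.
move=> c0; have cE v y : (c%:E * (F x + (inner (y - x) (c^-1 *: v))%:E) =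
    c%:E * F x + (inner (y - x) v)%:E)%E.
  by rewrite muleDr// -?EFinM ?innerZr ?mulVKf ?gt_eqF// fin_num_adde_defl.
by split=> xu y; have := xu y; rewrite -cE lee_pmul2l ?lte_fin.
Qed.

Lemma fenchel_young F x u : ((inner x u)%:E - F x <= conjugate F u)%E.
Proof. by apply: ereal_sup_ubound; exists x. Qed.

(** The equality case of the Fenchel-Young inequality. *)
Lemma conjugate_subdifferential F x u : F x \is a fin_num ->
  subdifferential F x u -> conjugate F u = ((inner x u)%:E - F x)%E.
Proof.
move=> Fx xu; apply/eqP; rewrite eq_le fenchel_young andbT.
apply: ge_ereal_sup => _ [y _ <-].
have := xu y; rewrite -(fineK Fx) -EFinD -EFinB.
case: (F y) => [b| |]; rewrite ?leNye//.
by rewrite -EFinB !lee_fin innerDl innerNl; lra.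
Qed.

Lemma subdifferential_conjugate F x u : F x \is a fin_num ->
  subdifferential F x u -> subdifferential (conjugate F) u x.
Proof.
move=> Fx xu v; rewrite (conjugate_subdifferential Fx xu).
apply: le_trans (fenchel_young F x v).
rewrite -(fineK Fx) -!EFinB -EFinD lee_fin !innerE (innerC u x) (innerC v x).
lra.
Qed.

(** Moreau's decomposition: with p the proximal point of F / c at w / c, the
    vector v = w - c p is a subgradient of F at p, hence p is a subgradient of
    the conjugate at v, which characterizes v as the proximal point of c F^* at
    w. Going through F yields a subgradient of F itself, the form in which the
    primal optimality conditions require it. *)
Lemma prox_conjugate_subdifferential F w x0 u0 (c : R) : 0 < c -> Gamma0 F ->
  subdifferential F x0 u0 ->
  subdifferential F
    (c^-1 *: (w - prox (fun v => c%:E * conjugate F v)%E w))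
    (prox (fun v => c%:E * conjugate F v)%E w).
Proof.
move=> c0 GF x0u0; have cV0 : 0 < c^-1 by rewrite invr_gt0.
pose p := prox (fun x => c^-1%:E * F x)%E (c^-1 *: w).
pose v := w - c *: p.
have pv : subdifferential F p v.
  suff : subdifferential (fun x => c^-1%:E * F x)%E p (c^-1 *: w - p).
    rewrite subdifferentialZ// invrK scalerBr scalerA divff ?gt_eqF//.
    by rewrite scale1r.
  apply: (@prox_subdifferential _ _ x0 (c^-1 *: u0)); first exact: Gamma0Z.
  by rewrite subdifferentialZ// invrK scalerA divff ?gt_eqF// scale1r.
have Fp : F p \is a fin_num.
  by case: GF => _ + _; move/subdifferential_fin_num; apply; exact: pv.
suff -> : prox (fun v => c%:E * conjugate F v)%E w = v.
  by rewrite subKr scalerA mulVf ?gt_eqF// scale1r.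
apply: prox_eq.
  by rewrite (conjugate_subdifferential Fp pv) fin_numM// fin_numB Fp.
rewrite subdifferentialZ// subKr scalerA mulVf ?gt_eqF// scale1r.
exact: subdifferential_conjugate.
Qed.

End ProximityOperator.

(** * Riesz representation, adjoints and gradients *)

Section Riesz.
Context {R : realType} {H : hilbertType R}.

(** The representing vector minimizes |y|^2 / 2 - phi y, whose Fermat rule reads
    phi z <= <z, p> for all z; applied to z and - z it is the equality. *)
Lemma riesz (phi : {linear H -> R^o}) (C : R) :
  (forall x, `|phi x| <= C * `|x|) -> exists a, forall x, phi x = inner x a.
Proof.
move=> phiC.
have NphiE x : - phi x = phi (- x) by rewrite linearN.
have GF : Gamma0 (fun x => (- phi x)%:E).
  split.
  - move=> x y t _; rewrite -!EFinM -EFinD lee_fin.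
    have -> : phi (t *: x + (1 - t) *: y) = t * phi x + (1 - t) * phi y.
      by rewrite linearD !linearZ.
    by move: (phi x : R) (phi y : R) => a b; lra.
  - by split=> [x|]; [|exists 0].
  - move=> x a; rewrite lte_fin => ax.
    have cphi : continuous phi.
      apply: bounded_linear_continuous; apply/linear_boundedP.
      near=> r => y; apply: le_trans (phiC y) _; rewrite ler_wpM2r//.
    exists [set y | a < - phi y] => //.
    exact: (@cvgr_gt _ _ (nbhs x) _ (fun y => - phi y) (- phi x) (cvgN (cphi x))).
have [p pmin] : exists p, argmin
    (fun y => (- phi y)%:E + (2^-1 * `|y - 0| ^+ 2)%:E)%E p.
  apply: (@argmin_prox_exists _ _ _ _ (- (2^-1 * C ^+ 2))) => // y.
  rewrite -EFinD lee_fin subr0.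
  have := phiC y; rewrite ler_norml => /andP[_].
  have : 0 <= (`|y| - C) ^+ 2 by exact: sqr_ge0.
  by rewrite sqrrB; lra.
have pS := argmin_prox_subdifferential GF pmin.
exists p; have le_phi z : phi z <= inner z p.
  have := pS (z + p); rewrite -EFinD lee_fin linearD addrK sub0r innerNr.
  by move: (phi z : R) (phi p : R) => a b; lra.
move=> x; apply/eqP; rewrite eq_le le_phi/=.
by have := le_phi (- x); rewrite linearN innerNl lerN2.
Unshelve. all: by end_near. Qed.

End Riesz.

Section Adjoint.
Context {R : realType} {H K : hilbertType R} (A : {linear H -> K}).
Hypothesis A_bounded : bounded_near A (nbhs (0 : H)).

Lemma bounded_linear_le : exists2 C, 0 < C & forall x, `|A x| <= C * `|x|.
Proof.
have /linear_boundedP/pinfty_ex_gt0[C C0 AC] := A_bounded.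
by exists C.
Qed.

Lemma adjointP x u : inner (A x) u = inner x (adjoint A u).
Proof.
have [C C0 AC] := bounded_linear_le.
pose phi : H -> R^o := fun y => inner (A y) u.
have phi_lin : linear phi.
  by move=> a y z; rewrite /phi linearP innerDl innerZl.
pose phiL := GRing.isLinear.Build _ _ _ _ phi phi_lin.
pose phi' : {linear H -> R^o} := HB.pack phi phiL.
have [|a aP] := @riesz _ _ phi' (C * `|u|).
  move=> y; apply: le_trans (abs_inner_le _ _) _.
  by rewrite mulrAC ler_wpM2r.
by have := xgetPex 0 (ex_intro [set x | forall y, inner (A y) u = inner y x] a aP); apply.
Qed.

Lemma adjointZ a u : adjoint A (a *: u) = a *: adjoint A u.
Proof. by apply: inner_inj => z; rewrite innerZr -!adjointP innerZr. Qed.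

End Adjoint.

Section Gradient.
Context {R : realType} {H : hilbertType R} (h : H -> R).
Hypothesis h_diff : forall x, differentiable (h : H -> R^o) x.

Lemma gradientP x v : 'd (h : H -> R^o) x v = inner v (gradient h x).
Proof.
have dc := diff_continuous (h_diff x).
have /linear_boundedP/pinfty_ex_gt0[C C0 AC] :=
  continuous_linear_bounded (0 : H) (dc 0).
have [a aP] := @riesz _ _ ('d (h : H -> R^o) x) C AC.
exact: (@xgetPex _ 0 [set g | forall v, 'd (h : H -> R^o) x v = inner v g]
  (ex_intro _ a aP)).
Qed.

End Gradient.

(** * Cocoercivity of the gradient *)

Section BaillonHaddad.
Context {R : realType} {H : hilbertType R} (h : H -> R) (G : H -> H).
Hypothesis h_diff : forall x, differentiable (h : H -> R^o) x.
Hypothesis GP : forall x v, 'd (h : H -> R^o) x v = inner v (G x).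

(** Restricting h to lines reduces the inequalities below to calculus on the real
    line. *)
Lemma is_derive_line x v (t : R) :
  is_derive t 1 (fun s : R => h (x + s *: v) : R^o) (inner v (G (x + t *: v))).
Proof.
have quotE :
    (fun r : R => r^-1 *: (((fun s => h (x + s *: v) : R^o) \o shift t) (r *: 1) -
      h (x + t *: v))) =
    (fun r : R => r^-1 *: (((h : H -> R^o) \o shift (x + t *: v)) (r *: v) -
      h (x + t *: v))).
  apply/funext => r /=; congr (_ *: (h _ - _)).
  by rewrite -[r *: 1]/(r * 1) mulr1 scalerDl addrCA.
have dh : derivable (h : H -> R^o) (x + t *: v) v by apply: diff_derivable.
apply: DeriveDef; rewrite /derivable /derive quotE//.
by rewrite -[LHS]/('D_v (h : H -> R^o) (x + t *: v)) deriveE// GP.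
Qed.

(** Difference quotients of a convex function are bounded by h y - h x; let the
    step tend to 0 from the right. *)
Lemma convex_gradient_le x y : convex_function setT h ->
  h x + inner (y - x) (G x) <= h y.
Proof.
move=> cvx; rewrite addrC -lerBrDr.
have [] := is_derive_line x (y - x) 0.
rewrite scale0r addr0 => + <-; rewrite /derivable.
move=> /cvg_dnbhs_at_right.
move=> /cvgr_to_le; apply.
near=> r.
have r01 : 0 <= r <= 1 by apply/andP; split; [|near: r; exact: nbhs_right_le].
have r0 : 0 < r by near: r; exact: nbhs_right_gt.
have /= := cvx (Itv01 (ltW r0) (proj2 (andP r01))) y x.
rewrite !inE => /(_ Logic.I Logic.I); rewrite convRE.
have -> : conv (Itv01 (ltW r0) (proj2 (andP r01)))
    (y : convex_lmodType H) (x : convex_lmodType H) = (x + r *: (y - x) : H).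
  by rewrite /conv/= scalerBl scale1r scalerBr addrCA.
rewrite scale0r !addr0 -[r%:A]/(r * 1) mulr1 -[_ *: (h _ - _)]/(r^-1 * _).
rewrite ler_pdivrMl//= => cvxr.
have : h (x + r *: (y - x)) <= r * h y + (1 - r) * h x := cvxr.
by move: (h _ : R) (h x : R) (h y : R) => a b c; lra.
Unshelve. all: by end_near. Qed.

(** The function phi below is nonincreasing on [0, 1] because the Lipschitz
    bound controls the variation of the directional derivative. *)
Lemma descent (beta : R) x y : 0 < beta -> beta.-lipschitz G ->
  h y <= h x + inner (y - x) (G x) + beta / 2 * `|y - x| ^+ 2.
Proof.
move=> b0 lip; set v := y - x; pose c := beta / 2 * `|v| ^+ 2.
pose phi (s : R) : R := h (x + s *: v) - s * inner v (G x) - s ^+ 2 * c.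
have dphi (s : R) : is_derive s 1 phi (inner v (G (x + s *: v)) -
    inner v (G x) - 2 * s * c).
  have := is_derive_line x v s => dl.
  apply: is_derive_eq; rewrite /GRing.scale/=.
  by move: (inner _ _) (inner _ _) (c) => a b k; ring.
have : phi 1 <= phi 0.
  apply: (@ler0_derive1_le_cc _ phi 0 1) => //; rewrite ?in_itv/= ?lexx ?ler01//.
  - move=> s /[!in_itv]/= /andP[s0 _]. rewrite derive1E. rewrite derive_val.
    have := lip (x + s *: v, x) (conj Logic.I Logic.I) => /=.
    rewrite addrAC subrr add0r normrZ gtr0_norm// => lip1.
    rewrite -innerNr -innerDr subr_le0 (le_trans (inner_le_norm _ _))//.
    rewrite (le_trans (ler_wpM2l _ lip1))// /c; lra.
  - by apply: derivable_within_continuous => s _.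
rewrite /phi /c scale1r scale0r addr0 subrKC; lra.
Qed.

(** Comparing the convexity inequality at a with the descent inequality at b in
    the point b + (G a - G b) / beta, which is the best choice, improves the
    convexity inequality by |G a - G b|^2 / (2 beta); exchanging a and b and
    adding the two gives cocoercivity. *)
Lemma baillon_haddad (beta : R) x y : 0 < beta -> convex_function setT h ->
  beta.-lipschitz G ->
  beta^-1 * `|G x - G y| ^+ 2 <=
  inner (x - y) (G x - G y).
Proof.
move=> b0 cvx lip.
have half a b : h a + inner (b - a) (G a) +
    beta^-1 / 2 * `|G a - G b| ^+ 2 <= h b.
  have [d dE] : {d | d = G a - G b} by exists (G a - G b).
  rewrite -dE.
  have := convex_gradient_le a (b + beta^-1 *: d) cvx.
  have := descent b (b + beta^-1 *: d) b0 lip.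
  rewrite [b + _]addrC addrK -addrA normrZ gtr0_norm ?invr_gt0// exprMn.
  rewrite !(innerDl, innerZl).
  have -> : inner d (G a) = `|d| ^+ 2 + inner d (G b).
    by rewrite sqrnormE [X in inner _ X + _]dE innerDr innerNr subrK.
  have -> : beta / 2 * (beta^-1 ^+ 2 * `|d| ^+ 2) = beta^-1 / 2 * `|d| ^+ 2.
    by field; rewrite gt_eqF.
  move: (beta^-1) => bV; lra.
have := half x y; have := half y x.
rewrite -(opprB (G x)) normrN innerDr innerNr -(opprB x) innerNl.
move: (beta^-1) => bV; lra.
Qed.
End BaillonHaddad.

(** * Limits along ultrafilters *)

(** Otherwise some neighborhood of c is missed on a set that meets every element
    of F0, and an ultrafilter containing F0 and this set contradicts the
    hypothesis. *)
Lemma cvg_ultra {T : Type} {U : topologicalType} (F0 : set_system T)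
    (u : T -> U) (c : U) : ProperFilter F0 ->
  (forall F, UltraFilter F -> F0 `<=` F -> u @ F --> c) -> u @ F0 --> c.
Proof.
move=> PF0 uF A Ac; apply: contrapT => nA.
pose D := ~` (u @^-1` A).
have PG : ProperFilter (within D F0).
  apply: Build_ProperFilter; rewrite /within/= => F0D.
  by apply: nA; apply: filterS F0D => x xD; apply: contrapT => /xD.
have [F [UF GF]] := ultraFilterLemma PG.
have F0F : F0 `<=` F.
  by move=> B F0B; apply: GF; rewrite /within/=; apply: filterS F0B.
have FA : F (u @^-1` A) by apply: uF.
have FD : F D by apply: GF; rewrite /within/=; exact: filterS filterT.
by apply: (@filter_not_empty _ F); apply: filterS2 FA FD => x.
Qed.

(** The image of an ultrafilter is an ultrafilter, and it contains a compact
    interval. *)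
Lemma bounded_ultra_cvg {R : realType} {T : Type} (F : set_system T)
    (u : T -> R) (B : R) :
  UltraFilter F -> (forall t, `|u t| <= B) -> exists c : R, u t @[t --> F] --> c.
Proof.
move=> UF uB.
have UG : UltraFilter (u @ F).
  split; first exact: fmap_proper_filter.
  move=> G PG FG; apply/seteqP; split => // A GA.
  have [//|nA] := in_ultra_setVsetC (u @^-1` A) UF.
  exfalso; apply: (@filter_not_empty _ G).
  by apply: filterS2 GA (FG (~` A) nA) => x.
have := @segment_compact R (- B) B; rewrite compact_ultra => /(_ _ UG)[].
  by apply: nearW => t; rewrite /= in_itv/= -ler_norml.
by move=> c [_ uc]; exists c.
Qed.

Lemma cvg0_sqr {R : realType} {T : Type} (F : set_system T) {FF : Filter F}
    (u r : T -> R) (B : R) :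
  (forall t, u t ^+ 2 <= r t * B) -> r @ F --> 0 -> u @ F --> 0.
Proof.
move=> ur r0; apply/cvgrPdist_lt => e e0.
have B0 : 0 < `|B| + 1 by rewrite ltr_wpDl.
have eB : 0 < e ^+ 2 / (`|B| + 1) by rewrite divr_gt0 ?exprn_gt0.
near=> t; rewrite sub0r normrN -(ltr_pXn2r (n:=2)) ?nnegrE ?(ltW e0)//.
rewrite real_normK ?num_real// (le_lt_trans (ur t))//.
rewrite (@le_lt_trans _ _ (`|r t| * (`|B| + 1)))//.
  by rewrite (le_trans (ler_norm _))// normrM ler_wpM2l// lerDl.
rewrite -ltr_pdivlMr//; near: t.
by have /cvgrPdist_lt/(_ _ eB) := r0; apply: filterS => t; rewrite sub0r normrN.
Unshelve. all: by end_near. Qed.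

(** * Krasnoselskii-Mann iterations *)

Section KrasnoselskiiMann.
Context {R : realType} {Z : lmodType R} (ip : Z -> Z -> R).
Hypothesis ipDl : forall x y z, ip (x + y) z = ip x z + ip y z.
Hypothesis ipZl : forall a x z, ip (a *: x) z = a * ip x z.
Hypothesis ipC : forall x y, ip x y = ip y x.
Hypothesis ip_ge0 : forall x, 0 <= ip x x.
Hypothesis ip_eq0 : forall x, ip x x = 0 -> x = 0.

Let ipNl x z : ip (- x) z = - ip x z.
Proof. by rewrite -scaleN1r ipZl mulN1r. Qed.
Let ipDr x y z : ip z (x + y) = ip z x + ip z y.
Proof. by rewrite ipC ipDl !(ipC z). Qed.
Let ipZr a x z : ip z (a *: x) = a * ip z x.
Proof. by rewrite ipC ipZl (ipC z). Qed.
Let ipNr x z : ip z (- x) = - ip z x.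
Proof. by rewrite ipC ipNl (ipC z). Qed.
Let ipE := (ipDl, ipDr, ipZl, ipZr, ipNl, ipNr).

Lemma form_cauchy_schwarz x y : ip x y ^+ 2 <= ip x x * ip y y.
Proof.
have [/ip_eq0 ->|y0] := eqVneq (ip y y) 0.
  have ip0 z : ip z 0 = 0 by rewrite -(scale0r 0) ipZr mul0r.
  by rewrite !ip0 expr0n mulr0.
have yy : 0 < ip y y by rewrite lt_neqAle eq_sym y0 ip_ge0.
have := ip_ge0 (ip y y *: x - ip x y *: y); rewrite !ipE (ipC y x).
rewrite [X in 0 <= X](_ : _ = ip y y * (ip x x * ip y y - ip x y ^+ 2)).
  by rewrite pmulr_rge0// subr_ge0.
by ring.
Qed.

Variables (Q : Z -> Z) (delta : R).
Hypothesis delta_gt0 : 0 < delta.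
Hypothesis Q_cocoercive : forall x y,
  delta / 2 * ip (Q x - Q y) (Q x - Q y) <= ip (Q x - Q y) (x - y).

Variables (rho : nat -> R) (z : nat -> Z).
Hypothesis rho_range : forall i, 0 <= rho i <= delta.
Hypothesis rho_series :
  (\sum_(0 <= i <oo) (rho i * (delta - rho i))%:E = +oo)%E.
Hypothesis zS : forall i, z i.+1 = z i - rho i *: Q (z i).

Let resid n := ip (Q (z n)) (Q (z n)).
Let dist2 s n := ip (z n - s) (z n - s).

(** Expand the square and apply cocoercivity between the iterate and s. *)
Lemma fejer s n : Q s = 0 ->
  dist2 s n.+1 <= dist2 s n - rho n * (delta - rho n) * resid n.
Proof.
move=> Qs; have := Q_cocoercive (z n) s; rewrite Qs subr0 /dist2 /resid zS.
rewrite addrAC; have /andP[r0 _] := rho_range n.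
move: (Q (z n)) (z n - s) => q d; rewrite !ipE (ipC d q); nra.
Qed.

(** The averaged operator is nonexpansive along the iterates: cocoercivity
    between consecutive iterates, whose difference is a multiple of Q (z n). *)
Lemma resid_nonincreasing : nonincreasing_seq resid.
Proof.
apply/nonincreasing_seqP => n; have /andP[r0 rd] := rho_range n.
have [rn0|rn0] := eqVneq (rho n) 0; first by rewrite /resid zS rn0 scale0r subr0.
have rgt0 : 0 < rho n by rewrite lt_neqAle eq_sym rn0.
have := Q_cocoercive (z n.+1) (z n); rewrite /resid.
move: (Q (z n.+1)) => q'; rewrite zS addrAC subrr add0r; move: (Q (z n)) => q.
rewrite -(subrK q q') addrK; move: (q' - q) => s; rewrite !ipE (ipC q s) => le1.
have : rho n * ip s s <= delta * ip s s by rewrite ler_wpM2r.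
move=> le2; have : rho n * (ip s s + 2 * ip s q) <= 0 by nra.
by rewrite pmulr_rle0//; lra.
Qed.

Lemma dist2_nonincreasing s : Q s = 0 -> nonincreasing_seq (dist2 s).
Proof.
move=> Qs; apply/nonincreasing_seqP => n; apply: le_trans (fejer n Qs) _.
rewrite lerBlDr lerDl mulr_ge0 ?ip_ge0//.
by have /andP[? ?] := rho_range n; rewrite mulr_ge0// subr_ge0.
Qed.

(** Telescope the Fejer inequality; the last residual is the smallest. *)
Lemma resid_sum s n : Q s = 0 ->
  resid n * \sum_(0 <= i < n) rho i * (delta - rho i) <= dist2 s 0.
Proof.
move=> Qs; apply: (@le_trans _ _ (dist2 s 0 - dist2 s n)); last first.
  by rewrite lerBlDr lerDl ip_ge0.
rewrite -lerN2 opprB -telescope_sumr// big_distrr/= -sumrN.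
rewrite !big_nat; apply: ler_sum => i /andP[_ ni].
have := fejer i Qs; have : resid n <= resid i by exact/resid_nonincreasing/ltnW.
have : 0 <= rho i * (delta - rho i).
  by have /andP[? ?] := rho_range i; rewrite mulr_ge0// subr_ge0.
move: (rho i * _) (resid n) (resid i) => a b c; nra.
Qed.

Lemma resid_cvg0 s : Q s = 0 -> resid n @[n --> \oo] --> 0.
Proof.
move=> Qs; apply/cvgrPdist_le => /= e e0.
(* The summand 1 keeps the partial sum positive even if z 0 = s. *)
have [N SN] : exists N,
    dist2 s 0 / e + 1 <= \sum_(0 <= i < N) rho i * (delta - rho i).
  apply: contrapT => /forallNP Sle.
  suff : (\sum_(0 <= i <oo) (rho i * (delta - rho i))%:E <=
          (dist2 s 0 / e + 1)%:E)%E by rewrite rho_series leye_eq.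
  apply: lime_le.
    apply: is_cvg_nneseries => n _ _; rewrite lee_fin.
    by have /andP[? ?] := rho_range n; rewrite mulr_ge0// subr_ge0.
  apply: nearW => n; rewrite sumEFin lee_fin.
  by have /negP := Sle n; rewrite -ltNge => /ltW.
exists N => // n /= Nn; rewrite sub0r normrN ger0_norm ?ip_ge0//.
apply: (le_trans (resid_nonincreasing Nn)).
have De0 : 0 <= dist2 s 0 / e by rewrite divr_ge0 ?ip_ge0// ltW.
have De : dist2 s 0 = dist2 s 0 / e * e by rewrite divfK ?gt_eqF.
have := resid_sum N Qs; rewrite De; move: SN De0.
move: (dist2 s 0 / e) (\sum_(_ <= _ < _) _) (resid N) => a S r aS a0 rS.
have S0 : 0 < S by lra.
by rewrite -(ler_pM2r S0) (le_trans rS)// mulrC ler_pM2l//; lra.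
Qed.

Variable s : Z.
Hypothesis Qs : Q s = 0.

Lemma dist2_bounded l : exists B, forall n, dist2 l n <= B.
Proof.
exists (2 * dist2 s 0 + 2 * ip (s - l) (s - l)) => n.
have := dist2_nonincreasing Qs (leq0n n).
have := ip_ge0 ((z n - s) - (s - l)); rewrite /dist2.
have -> : z n - l = (z n - s) + (s - l) by rewrite addrA subrK.
move: (z n - s) (s - l) => a b; rewrite !ipE (ipC b a); lra.
Qed.

(** Cocoercivity between the iterates and l: in the limit its right-hand side
    vanishes, as Q (z n) tends to 0 strongly and z n - l tends to 0 weakly, while
    the left-hand side becomes delta / 2 |Q l|^2. *)
Lemma demiclosed (F : set_system nat) l : ProperFilter F -> \oo `<=` F ->
  (forall v, ip (z n) v @[n --> F] --> ip l v) -> Q l = 0.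
Proof.
move=> PF ooF zl.
have r0 : resid n @[n --> F] --> 0 by move=> A /(resid_cvg0 Qs) /ooF.
have [B dB] := dist2_bounded l.
have u0 : ip (Q (z n)) (z n - l) @[n --> F] --> 0.
  apply: (@cvg0_sqr _ _ _ _ _ resid B) => // n.
  apply: le_trans (form_cauchy_schwarz _ _) _.
  by apply: ler_wpM2l; [exact: ip_ge0|exact: dB].
have v0 : ip (Q (z n)) (Q l) @[n --> F] --> 0.
  apply: (@cvg0_sqr _ _ _ _ _ resid (ip (Q l) (Q l))) => // n.
  exact: form_cauchy_schwarz.
have w0 : ip (z n) (Q l) - ip l (Q l) @[n --> F] --> 0.
  by rewrite -(subrr (ip l (Q l))); apply: cvgB => //; exact: cvg_cst.
have e0 : ip (Q (z n)) (z n - l) - (ip (z n) (Q l) - ip l (Q l))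
    - delta / 2 * resid n + delta * ip (Q (z n)) (Q l) @[n --> F] -->
    0 - 0 - delta / 2 * 0 + delta * 0.
  by apply: cvgD; [apply: cvgB; [exact: cvgB|exact: cvgMl_tmp]|exact: cvgMl_tmp].
apply: ip_eq0; apply/eqP; rewrite eq_le ip_ge0 andbT.
rewrite -(@pmulr_rle0 _ (delta / 2)) ?divr_gt0//.
have -> : 0 = 0 - 0 - delta / 2 * 0 + delta * 0 by ring.
apply: (cvgr_to_ge e0); apply: nearW => n.
have := Q_cocoercive (z n) l; rewrite /resid.
move: (z n) (Q l) (Q (z n)) => y ql q.
rewrite !ipE (ipC ql q) (ipC ql y) (ipC ql l); lra.
Qed.

(** Opial's argument: the squared distances to l1 and l2 both converge, hence so
    does their difference, which is affine in the iterate with linear part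
    -2 <., l1 - l2>. Its limits along F1 and F2 agree. *)
Lemma weak_cluster_unique (F1 F2 : set_system nat) l1 l2 :
  ProperFilter F1 -> ProperFilter F2 -> \oo `<=` F1 -> \oo `<=` F2 ->
  (forall v, ip (z n) v @[n --> F1] --> ip l1 v) ->
  (forall v, ip (z n) v @[n --> F2] --> ip l2 v) -> l1 = l2.
Proof.
move=> PF1 PF2 oo1 oo2 z1 z2.
have Q1 := demiclosed PF1 oo1 z1; have Q2 := demiclosed PF2 oo2 z2.
have cvgd l : Q l = 0 -> cvgn (dist2 l).
  move=> Ql; apply: nonincreasing_is_cvgn; first exact: dist2_nonincreasing.
  by exists 0 => _ [n _ <-]; exact: ip_ge0.
have [c zc] : exists c : R, ip (z n) (l1 - l2) @[n --> \oo] --> c.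
  exists (2^-1 * (lim (dist2 l2 @ \oo) - lim (dist2 l1 @ \oo) + (ip l1 l1 - ip l2 l2))).
  have zE : (fun n => ip (z n) (l1 - l2)) =
      (fun n => 2^-1 * (dist2 l2 n - dist2 l1 n + (ip l1 l1 - ip l2 l2))).
    apply/funext => n; rewrite /dist2 !ipE (ipC l1 (z n)) (ipC l2 (z n)).
    by field.
  rewrite zE; apply: cvgMl_tmp; apply: cvgD; last exact: cvg_cst.
  by apply: cvgB; exact: cvgd.
have c1 : c = ip l1 (l1 - l2).
  apply: (cvg_unique _ _ (z1 (l1 - l2))) => //.
  by move=> A /zc /oo1.
have c2 : c = ip l2 (l1 - l2).
  apply: (cvg_unique _ _ (z2 (l1 - l2))) => //.
  by move=> A /zc /oo2.
apply/eqP; rewrite -subr_eq0; apply/eqP/ip_eq0.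
by rewrite ipDl ipNl -c1 -c2 subrr.
Qed.

(** The weak topology is given by a family phi of functionals, along with the
    requirement that bounded sequences have limits for it that are also limits
    against ip. Thus the form that makes Q cocoercive may differ from the inner
    product in which weak convergence is stated. *)
Theorem krasnoselskii_mann {T : Type} (phi : T -> Z -> R) :
  (forall (F : set_system nat) (y : nat -> Z) (B : R), UltraFilter F ->
    (forall n, ip (y n) (y n) <= B) ->
    exists l, (forall t, phi t (y n) @[n --> F] --> phi t l) /\
              (forall v, ip (y n) v @[n --> F] --> ip l v)) ->
  exists2 l, Q l = 0 & forall t, phi t (z n) @[n --> \oo] --> phi t l.
Proof.
move=> wcompact.
have [B zB] : exists B, forall n, ip (z n) (z n) <= B.
  by have [B dB] := dist2_bounded 0; exists B => n; have := dB n; rewrite /dist2 subr0.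
have [F0 [UF0 ooF0]] := @ultraFilterLemma nat \oo _.
have [l [_ zl]] := wcompact F0 z B UF0 zB.
exists l; first exact: demiclosed zl.
move=> t; apply: cvg_ultra => F UF ooF.
have [l' [tl' zl']] := wcompact F z B UF zB.
by rewrite (weak_cluster_unique _ _ ooF0 ooF zl zl').
Qed.

End KrasnoselskiiMann.

(** * Products of families of modules *)

(** An alias, so that the pointwise module structure is found on dependent
    functions. *)
Definition dprod {R : pzRingType} {I : Type} (U : I -> lmodType R) : Type :=
  forall i, U i.

Section DependentProduct.
Context {R : pzRingType} {I : Type} (U : I -> lmodType R).
Implicit Types u v w : dprod U.

HB.instance Definition _ := gen_eqMixin (dprod U).
HB.instance Definition _ := gen_choiceMixin (dprod U).

Let add u v : dprod U := fun i => u i + v i.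
Let opp u : dprod U := fun i => - u i.
Let zero : dprod U := fun i => 0.
Let scale (a : R) u : dprod U := fun i => a *: u i.

Let addA : associative add.
Proof. by move=> u v w; apply/functional_extensionality_dep => i; exact: addrA. Qed.
Let addC : commutative add.
Proof. by move=> u v; apply/functional_extensionality_dep => i; exact: addrC. Qed.
Let add0 : left_id zero add.
Proof. by move=> u; apply/functional_extensionality_dep => i; exact: add0r. Qed.
Let addN : left_inverse zero opp add.
Proof. by move=> u; apply/functional_extensionality_dep => i; exact: addNr. Qed.

HB.instance Definition _ :=
  GRing.isZmodule.Build (dprod U) addA addC add0 addN.

Let scaleA a b u : scale a (scale b u) = scale (a * b) u.
Proof. by apply/functional_extensionality_dep => i; exact: scalerA. Qed.
Let scale1 : left_id 1 scale.
Proof. by move=> u; apply/functional_extensionality_dep => i; exact: scale1r. Qed.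
Let scaleDr : right_distributive scale +%R.
Proof. by move=> a u v; apply/functional_extensionality_dep => i; exact: scalerDr. Qed.
Let scaleDl u : {morph scale^~ u : a b / a + b}.
Proof. by move=> a b; apply/functional_extensionality_dep => i; exact: scalerDl. Qed.

HB.instance Definition _ :=
  GRing.Zmodule_isLmodule.Build R (dprod U) scaleA scale1 scaleDr scaleDl.

End DependentProduct.

Lemma cvg_sum_ord {R : realType} {T : Type} (F : set_system T) {FF : Filter F}
    (M : nat) (u : 'I_M -> T -> R) (l : 'I_M -> R) :
  (forall m, u m t @[t --> F] --> l m) ->
  \sum_(m < M) u m t @[t --> F] --> \sum_(m < M) l m.
Proof.
elim: M u l => [|M IH] u l ul.
  rewrite big_ord0 (_ : (fun t => _) = cst 0); first exact: cvg_cst.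
  by apply/funext => t; rewrite big_ord0.
rewrite big_ord_recl (_ : (fun t => _) =
  (fun t => u ord0 t + \sum_(m < M) u (lift ord0 m) t)).
  by apply: cvgD => //; apply: IH.
by apply/funext => t; rewrite big_ord_recl.
Qed.

(** The limits of the inner products with each vector form a bounded linear
    functional, represented by the weak limit. *)
Lemma hilbert_ultra_weak_cvg {R : realType} {H : hilbertType R} {T : Type}
    (F : set_system T) (s : T -> H) (C : R) :
  UltraFilter F -> (forall t, inner (s t) (s t) <= C) ->
  exists l, forall v, inner (s t) v @[t --> F] --> inner l v.
Proof.
move=> UF sC; pose D := Num.sqrt C.
have sD t : `|s t| <= D.
  have C0 : 0 <= C by apply: le_trans (sC t); exact: inner_ge0.
  by rewrite -(ler_pXn2r (n:=2)) ?nnegrE ?sqrtr_ge0// sqr_sqrtr// sqrnormE.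
have bd v t : `|inner (s t) v| <= D * `|v|.
  by apply: le_trans (abs_inner_le _ _) _; rewrite ler_wpM2r.
have /choice[psi psiE] v : exists c : R, inner (s t) v @[t --> F] --> c.
  exact: bounded_ultra_cvg (bd v).
pose phi : H -> R^o := psi.
have phi_lin : linear phi.
  move=> a x y; apply: (cvg_unique _ (psiE (a *: x + y))) => //.
  have -> : (fun t => inner (s t) (a *: x + y)) =
      (fun t => a * inner (s t) x + inner (s t) y).
    by apply/funext => t; rewrite innerDr innerZr.
  by apply: cvgD => //; exact: cvgMl_tmp.
pose phiL := GRing.isLinear.Build _ _ _ _ phi phi_lin.
pose phi' : {linear H -> R^o} := HB.pack phi phiL.
have [|l lE] := @riesz _ _ phi' D.
  move=> v; apply: (@cvgr_to_le _ F _ _ (fun t => `|inner (s t) v|)).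
    exact: (cvg_norm (psiE v)).
  by apply: nearW => t; exact: bd.
by exists l => v; rewrite innerC -lE; exact: psiE.
Qed.

(** * The primal-dual metric *)

Section PrimalDualMetric.
Context {R : realType} (M : nat) (X : hilbertType R) (U : 'I_M -> hilbertType R).
Variables (L : forall m, {linear X -> U m}) (Ls : forall m, U m -> X).
Hypothesis LsP : forall m x u, inner (L m x) u = inner x (Ls u).
Variables (tau : R) (sigma : 'I_M -> R) (normL eps : R).
Hypothesis sigma_gt0 : forall m, 0 < sigma m.
Hypothesis normLP : forall x,
  \sum_(m < M) sigma m * inner (L m x) (L m x) <= normL * inner x x.
Hypothesis kappa_gt0 : 0 < tau^-1 - normL.
Hypothesis eps2 : eps ^+ 2 = 1.

Let Z := (X * dprod (fun m => U m : lmodType R))%type.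

(** The bilinear form of the operator P; [eps] is -1 or 1 according to the form
    of the algorithm. *)
Definition pd_form (z w : Z) : R := tau^-1 * inner z.1 w.1 +
  \sum_(m < M) (eps * (inner (L m z.1) (w.2 m) + inner (L m w.1) (z.2 m)) +
    (sigma m)^-1 * inner (z.2 m) (w.2 m)).

Lemma pd_formC z w : pd_form z w = pd_form w z.
Proof.
rewrite /pd_form innerC; congr (_ + _); apply: eq_bigr => m _.
by rewrite (innerC (z.2 m)) [_ + inner (L m w.1) _]addrC.
Qed.

Lemma pd_formDl x y z : pd_form (x + y) z = pd_form x z + pd_form y z.
Proof.
rewrite /pd_form addrACA -mulrDr -innerDl -big_split/=; congr (_ + _).
apply: eq_bigr => m _; rewrite linearD !innerE; ring.
Qed.

Lemma pd_formZl a x z : pd_form (a *: x) z = a * pd_form x z.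
Proof.
rewrite /pd_form mulrDr mulr_sumr/= innerZl mulrCA; congr (_ + _).
by apply: eq_bigr => m _; rewrite linearZ !innerE; ring.
Qed.

Lemma pd_formE z w : pd_form z w =
  inner (tau^-1 *: z.1 + eps *: \sum_(m < M) Ls (z.2 m)) w.1 +
  \sum_(m < M) inner ((sigma m)^-1 *: z.2 m + eps *: L m z.1) (w.2 m).
Proof.
rewrite /pd_form innerDl !innerZl [inner (\sum_(_ < _) _) _]innerC inner_sumr.
rewrite -addrA; congr (_ + _).
rewrite mulr_sumr -big_split; apply: eq_bigr => m _ /=.
by rewrite -LsP !innerE; ring.
Qed.

(** Complete the square in each dual variable. *)
Lemma pd_form_sqr z : pd_form z z =
  tau^-1 * inner z.1 z.1 - \sum_(m < M) sigma m * inner (L m z.1) (L m z.1) +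
  \sum_(m < M) (sigma m)^-1 * inner (z.2 m + (eps * sigma m) *: L m z.1)
                                    (z.2 m + (eps * sigma m) *: L m z.1).
Proof.
rewrite /pd_form -addrA; congr (_ + _).
rewrite -sumrN -big_split; apply: eq_bigr => m _ /=.
rewrite !innerE (innerC (z.2 m)).
have s0 : sigma m != 0 by rewrite gt_eqF.
move: (inner (L m z.1) (z.2 m)) (inner (L m z.1) (L m z.1)) => a b.
move: (inner (z.2 m) (z.2 m)) => c.
transitivity (- (eps ^+ 2 * (sigma m * b)) + (sigma m)^-1 *
  (c + eps * sigma m * a + (eps * sigma m * (a + eps * sigma m * b)))).
  by field.
by rewrite eps2 mul1r; congr (- _ + _ * _); ring.
Qed.

Let sq_sum_ge0 z : 0 <=
  \sum_(m < M) (sigma m)^-1 * inner (z.2 m + (eps * sigma m) *: L m z.1)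
                                    (z.2 m + (eps * sigma m) *: L m z.1).
Proof.
by apply: sumr_ge0 => m _; rewrite mulr_ge0 ?inner_ge0// invr_ge0 ltW.
Qed.

Lemma pd_form_ge z : (tau^-1 - normL) * inner z.1 z.1 <= pd_form z z.
Proof.
rewrite pd_form_sqr mulrBl; have := normLP z.1; have := sq_sum_ge0 z; lra.
Qed.

Lemma pd_form_ge0 z : 0 <= pd_form z z.
Proof.
by apply: le_trans (pd_form_ge z); rewrite mulr_ge0 ?inner_ge0// ltW.
Qed.

Lemma pd_form_ge_dual z m : inner (z.2 m + (eps * sigma m) *: L m z.1)
  (z.2 m + (eps * sigma m) *: L m z.1) <= sigma m * pd_form z z.
Proof.
rewrite -ler_pdivrMl//; apply: (@le_trans _ _
  (\sum_(m < M) (sigma m)^-1 * inner (z.2 m + (eps * sigma m) *: L m z.1)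
                                    (z.2 m + (eps * sigma m) *: L m z.1))).
  rewrite (bigD1 m)//= lerDl; apply: sumr_ge0 => k _.
  by rewrite mulr_ge0 ?inner_ge0// invr_ge0 ltW.
rewrite pd_form_sqr lerDr; have := normLP z.1.
have : 0 <= (tau^-1 - normL) * inner z.1 z.1 by rewrite mulr_ge0 ?inner_ge0// ltW.
rewrite mulrBl; lra.
Qed.

Lemma pd_form_eq0 z : pd_form z z = 0 -> z = 0.
Proof.
move=> z0; have z10 : z.1 = 0.
  apply: inner_eq0; apply/eqP; rewrite eq_le inner_ge0 andbT.
  by rewrite -(pmulr_rle0 _ kappa_gt0) -z0 pd_form_ge.
rewrite [z]surjective_pairing [RHS]surjective_pairing; congr (_, _) => //.
apply/functional_extensionality_dep => m; apply: inner_eq0; apply/eqP.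
rewrite eq_le inner_ge0 andbT; have := pd_form_ge_dual z m.
by rewrite z0 mulr0 z10 linear0 scaler0 addr0.
Qed.

(** The form bounds the primal component and the shifted dual components
    u_m + eps sigma_m L_m x, which have weak limits; the shift is weakly
    continuous. *)
Lemma pd_form_ultra_compact (F : set_system nat) (y : nat -> Z) (B : R) :
  UltraFilter F -> (forall n, pd_form (y n) (y n) <= B) ->
  exists l : Z, (forall w : Z, inner (y n).1 w.1 + sum_inner (y n).2 w.2 @[n --> F] -->
      inner l.1 w.1 + sum_inner l.2 w.2) /\
    (forall v, pd_form (y n) v @[n --> F] --> pd_form l v).
Proof.
move=> UF yB.
have [l1 l1P] : exists l, forall v, inner (y n).1 v @[n --> F] --> inner l v.
  apply: (@hilbert_ultra_weak_cvg _ _ _ _ _ (B / (tau^-1 - normL))) => n.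
  by rewrite ler_pdivlMr// mulrC (le_trans (pd_form_ge _)).
have /all_sig[l2 l2P] m : {l | forall v, inner ((y n).2 m) v @[n --> F] --> inner l v}.
  apply: cid.
  have [l lP] := @hilbert_ultra_weak_cvg _ _ _ F
    (fun n => (y n).2 m + (eps * sigma m) *: L m (y n).1) (sigma m * B) UF
    (fun n => le_trans (pd_form_ge_dual _ _) (ler_wpM2l (ltW (sigma_gt0 m)) (yB n))).
  exists (l - (eps * sigma m) *: L m l1) => v.
  have -> : (fun n => inner ((y n).2 m) v) =
      (fun n => inner ((y n).2 m + (eps * sigma m) *: L m (y n).1) v -
                (eps * sigma m) * inner (y n).1 (Ls v)).
    by apply/funext => n; rewrite !innerE LsP; ring.
  rewrite !innerE LsP; apply: cvgB => //.
  exact: cvgMl_tmp.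
exists (l1, l2); split=> [w|v].
  by apply: cvgD => //; apply: cvg_sum_ord => m.
rewrite pd_formC pd_formE; under eq_fun do rewrite pd_formC pd_formE.
apply: cvgD; first by rewrite innerC; under eq_fun do rewrite innerC; exact: l1P.
apply: cvg_sum_ord => m; rewrite innerC; under eq_fun do rewrite innerC.
exact: l2P.
Qed.

Variables (G : X -> X) (beta : R).
Hypothesis beta_gt0 : 0 < beta.
Hypothesis G_cocoercive : forall x y,
  beta^-1 * inner (G x - G y) (G x - G y) <= inner (x - y) (G x - G y).
Variables (A : X -> X -> Prop) (B : forall m, U m -> U m -> Prop).
Hypothesis A_monotone : forall x y a b, A x a -> A y b ->
  0 <= inner (a - b) (x - y).
Hypothesis B_monotone : forall m (x y a b : U m), B x a -> B y b ->
  0 <= inner (x - y) (a - b).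

(** The vector [a] is the element of A x for which the inclusion holds. *)
Definition kkt (x : X) (u : forall m, U m) (a : X) : Prop :=
  [/\ A x a, forall m, B (L m x) (u m) & 0 = a + \sum_(m < M) Ls (u m) + G x].

(** The inclusion P (z - t) \in C z + S t characterizing the half step t of z;
    [a] and [b] are the elements of A and B^-1 for which it holds. *)
Definition pd_step (z t : Z) (a : X) (b : forall m, U m) : Prop :=
  [/\ A t.1 a, forall m, B (b m) (t.2 m),
      tau^-1 *: (z.1 - t.1) + eps *: \sum_(m < M) Ls (z.2 m - t.2 m) =
        G z.1 + a + \sum_(m < M) Ls (t.2 m)
    & forall m, (sigma m)^-1 *: (z.2 m - t.2 m) + eps *: L m (z.1 - t.1) =
        b m - L m t.1].

Lemma pd_step_form z t a b w : pd_step z t a b ->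
  pd_form (z - t) w = inner (G z.1 + a + \sum_(m < M) Ls (t.2 m)) w.1 +
    \sum_(m < M) inner (b m - L m t.1) (w.2 m).
Proof.
move=> [_ _ e1 e2]; rewrite pd_formE -e1; congr (_ + _).
by apply: eq_bigr => m _; rewrite -e2.
Qed.

(** The skew part (sum_m L_m^* u_m, - L x) of S contributes 0. *)
Lemma saddle_monotone (x y a b : X) (u v c d : forall m, U m) :
  A x a -> A y b -> (forall m, B (c m) (u m)) -> (forall m, B (d m) (v m)) ->
  0 <= inner ((a + \sum_(m < M) Ls (u m)) - (b + \sum_(m < M) Ls (v m))) (x - y) +
    \sum_(m < M) inner ((c m - L m x) - (d m - L m y)) (u m - v m).
Proof.
move=> Axa Ayb Bcu Bdv; rewrite opprD addrACA -sumrB innerDl.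
rewrite [inner (\sum_(_ < _) _) _]innerC inner_sumr -addrA -big_split/=.
rewrite addr_ge0 ?A_monotone//; apply: sumr_ge0 => m _.
have := B_monotone (Bcu m) (Bdv m).
rewrite !(innerDl, innerDr, innerNl, innerNr) -!LsP; lra.
Qed.

Variable T : Z -> Z.
Hypothesis T_step : forall z, exists a b, pd_step z (T z) a b.

Lemma pd_residual_form z z' :
  inner (G z.1 - G z'.1) ((T z).1 - (T z').1) <=
  pd_form ((z - T z) - (z' - T z')) (T z - T z').
Proof.
have [a [b zT]] := T_step z; have [a' [b' zT']] := T_step z'.
have [Aa Bb _ _] := zT; have [Aa' Bb' _ _] := zT'.
have pd_formNl x y : pd_form (- x) y = - pd_form x y.
  by rewrite -scaleN1r pd_formZl mulN1r.
rewrite pd_formDl pd_formNl (pd_step_form _ zT) (pd_step_form _ zT').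
have := saddle_monotone Aa Aa' Bb Bb'.
under [X in _ <= _ + X -> _]eq_bigr do rewrite innerDl innerNl.
rewrite sumrB.
rewrite -!(addrA (G _)) !(innerDl (G _)) !(innerDl _ (- _)) !innerNl /=.
lra.
Qed.

Definition pd_delta := 2 - beta / 2 * (tau^-1 - normL)^-1.

(** The forward term costs <c, q>, with c the difference of the gradients and q
    the primal part of the difference of the residuals. Cocoercivity of G and
    Young's inequality bound it by beta / 4 |q|^2, and [pd_form_ge] turns this
    into a multiple of the form. *)
Lemma pd_residual_cocoercive z z' :
  pd_delta / 2 * pd_form ((z - T z) - (z' - T z')) ((z - T z) - (z' - T z')) <=
  pd_form ((z - T z) - (z' - T z')) (z - z').
Proof.
have := pd_residual_form z z'; set q := (z - T z) - (z' - T z').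
have dE : z - z' = q + (T z - T z').
  by rewrite /q opprB addrACA subrK [T z' - z']addrC addrK.
move=> res; rewrite [leRHS](_ : _ = pd_form q q + pd_form q (T z - T z')); last first.
  by rewrite dE pd_formC pd_formDl !(pd_formC _ q).
move: res; have -> : (T z).1 - (T z').1 = (z.1 - z'.1) - q.1.
  have -> : z.1 - z'.1 = q.1 + ((T z).1 - (T z').1) by rewrite -[LHS]/((z - z').1) dE.
  by rewrite [RHS]addrC addKr.
have := pd_form_ge q; have := G_cocoercive z.1 z'.1.
(* Young's inequality <c, q> <= |c|^2 / beta + beta / 4 |q|^2. *)
have := inner_ge0 ((G z.1 - G z'.1) - (beta / 2) *: q.1).
move: (pd_form q (T z - T z')) (pd_form q q) => E N.
move: (G z.1 - G z'.1) (z.1 - z'.1) q.1 => c d r.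
rewrite !(innerDl, innerDr, innerNl, innerNr, innerZl, innerZr) (innerC r c) (innerC d c).
rewrite -(ler_pdivlMl _ _ kappa_gt0) /pd_delta.
move: (inner c c) (inner c r) (inner c d) (inner r r) => cc cr cd rr.
move=> young coc; rewrite -(ler_pM2l (_ : 0 < beta / 4)) ?divr_gt0// => rN.
move: young; rewrite -(pmulr_rge0 _ (_ : 0 < beta^-1)) ?invr_gt0//.
rewrite [X in 0 <= X -> _](_ : _ = beta^-1 * cc - cr + beta / 4 * rr); last first.
  by field; rewrite gt_eqF.
move: (beta^-1 * cc) (beta / 4 * rr) coc rN => bcc brr coc rN.
have -> : (2 - beta / 2 / (tau^-1 - normL)) / 2 * N =
    N - beta / 4 * ((tau^-1 - normL)^-1 * N).
  by move: ((tau^-1 - normL)^-1) => k; field.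
lra.
Qed.

(** Monotonicity of S between z and T z makes the form nonpositive at
    z - T z, the forward terms cancelling as both are evaluated at z. *)
Lemma kkt_fixed (z : Z) a : kkt z.1 z.2 a -> T z = z.
Proof.
move=> [Axa Bu kkt0]; have [a' [b' zT]] := T_step z.
have [Aa' Bb' _ _] := zT.
apply/eqP; rewrite eq_sym -subr_eq0; apply/eqP; apply: pd_form_eq0; apply/eqP.
rewrite eq_le pd_form_ge0 andbT -oppr_ge0.
have -> : - pd_form (z - T z) (z - T z) =
    pd_form (z - T z) (T z - z).
  have e : T z - z = (-1) *: (z - T z) by rewrite scaleN1r opprB.
  by rewrite [in RHS]e [RHS]pd_formC pd_formZl mulN1r.
rewrite (pd_step_form _ zT) /=.
have := saddle_monotone Aa' Axa Bb' Bu.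
congr (0 <= inner _ _ + _).
  have -> : G z.1 = - (a + \sum_(m < M) Ls (z.2 m)).
    by apply/eqP; rewrite -addr_eq0 addrC eq_sym; apply/eqP.
  by rewrite addrC addrA.
by apply: eq_bigr => m _; rewrite subrr subr0.
Qed.

Lemma fixed_kkt z : T z = z -> exists a, kkt z.1 z.2 a.
Proof.
move=> Tz; have [a [b []]] := T_step z; rewrite Tz => Aa Bb e1 e2.
exists a; split=> // [m|].
  have := e2 m; rewrite !subrr (linear0 (L m)) !scaler0 addr0 => /esym/subr0_eq <-.
  exact: Bb.
move: e1; rewrite subrr scaler0 add0r big1 ?scaler0 => [e|m _].
  by rewrite [LHS]e [RHS]addrAC [a + _]addrC.
by rewrite subrr; apply: inner_inj => x; rewrite -LsP !inner0r.
Qed.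

Theorem pd_converges (rho : nat -> R) (z : nat -> Z) :
  0 < pd_delta -> (exists x u a, kkt x u a) ->
  (forall i, 0 <= rho i <= pd_delta) ->
  (\sum_(0 <= i <oo) (rho i * (pd_delta - rho i))%:E = +oo)%E ->
  (forall i, z i.+1 = z i - rho i *: (z i - T (z i))) ->
  exists2 l : Z, exists a, kkt l.1 l.2 a &
    forall w : Z, inner (z n).1 w.1 + sum_inner (z n).2 w.2 @[n --> \oo] -->
      inner l.1 w.1 + sum_inner l.2 w.2.
Proof.
move=> delta0 [x0 [u0 [a0 kkt0]]] rho_range rho_series zS.
have T0 : ((x0, u0) : Z) - T (x0, u0) = 0.
  by rewrite (@kkt_fixed (x0, u0) a0 kkt0) subrr.
have [l Ql zl] := krasnoselskii_mann pd_formDl pd_formZl pd_formC pd_form_ge0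
  pd_form_eq0 (Q := fun z => z - T z) delta0 pd_residual_cocoercive rho_range
  rho_series zS (s := (x0, u0)) T0 pd_form_ultra_compact.
by exists l => //; apply: fixed_kkt; apply/esym/subr0_eq.
Qed.

End PrimalDualMetric.

(** * Optimality of the solutions of the inclusions *)

(** By homogeneity it suffices to look at the unit ball; the bound C makes the
    supremum that of a bounded set. *)
Lemma opnormP {R : realType} {X Y : normedModType R} (A : X -> Y) (C : R) :
  (forall a x, A (a *: x) = a *: A x) -> (forall x, `|A x| <= C * `|x|) ->
  forall x, `|A x| <= opnorm A * `|x|.
Proof.
move=> AZ AC x; have [->|x0] := eqVneq x 0.
  by have := AZ 0 0; rewrite !scale0r => ->; rewrite !normr0 mulr0.
rewrite -ler_pdivrMr ?normr_gt0//; apply: ub_le_sup.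
  exists `|C| => _ [y /= y1 <-]; apply: le_trans (AC y) _.
  rewrite (le_trans (ler_norm _))// normrM ler_piMr// normr_id//.
exists (`|x|^-1 *: x) => /=.
  by rewrite normrZ normfV normr_id mulVf// normr_eq0.
by rewrite AZ normrZ normfV normr_id mulrC.
Qed.

Lemma subdifferential_monotone {R : realType} {H : hilbertType R}
    (F : H -> \bar R) x y u v : Defs.proper F ->
  subdifferential F x u -> subdifferential F y v -> 0 <= inner (u - v) (x - y).
Proof.
move=> pF xu yv; have := xu y; have := yv x.
rewrite -(fineK (subdifferential_fin_num pF xu)).
rewrite -(fineK (subdifferential_fin_num pF yv)).
rewrite -!EFinD !lee_fin !innerE.
rewrite (innerC u x) (innerC u y) (innerC v x) (innerC v y); lra.
Qed.

Section Optimality.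
Context {R : realType} (M : nat) (X : hilbertType R) (U : 'I_M -> hilbertType R).
Variables (f : X -> \bar R) (g : forall m, U m -> \bar R) (h : X -> R) (G : X -> X).
Variables (L : forall m, {linear X -> U m}) (Ls : forall m, U m -> X).
Hypothesis f_proper : Defs.proper f.
Hypothesis g_proper : forall m, Defs.proper (@g m).
Hypothesis h_ge : forall x y, h x + inner (y - x) (G x) <= h y.
Hypothesis LsP : forall m x u, inner (L m x) u = inner x (Ls u).
Variables (x a : X) (u : forall m, U m).
Hypothesis xu_kkt : kkt L Ls G (subdifferential f)
  (fun m => subdifferential (@g m)) x u a.

Let fx : f x \is a fin_num.
Proof. by have [xa _ _] := xu_kkt; exact: subdifferential_fin_num xa. Qed.

Let gLx m : g (L m x) \is a fin_num.
Proof. by have [_ gu _] := xu_kkt; exact: subdifferential_fin_num (gu m). Qed.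

Let GE : G x = - a - \sum_(m < M) Ls (u m).
Proof.
have [_ _ kkt0] := xu_kkt.
by apply/eqP; rewrite -opprD -addr_eq0 addrC eq_sym; apply/eqP.
Qed.

(** Add the subgradient inequalities of all the terms: the linear parts sum to
    0. *)
Lemma kkt_argmin_primal :
  argmin (fun y => f y + \sum_(m < M) g (L m y) + (h y)%:E)%E x.
Proof.
have [xa gu _] := xu_kkt; move=> y.
apply: (@le_trans _ _ ((f x + (inner (y - x) a)%:E) +
  \sum_(m < M) (g (L m x) + (inner (L m y - L m x) (u m))%:E) +
  (h x + inner (y - x) (G x))%:E)%E).
  rewrite -(fineK fx).
  under eq_bigr do rewrite -(fineK (gLx _)).
  under [X in (_ <= _ + X + _)%E]eq_bigr do rewrite -(fineK (gLx _)) -EFinD.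
  rewrite !sumEFin -!EFinD lee_fin big_split/= GE !innerDr !innerNr inner_sumr.
  under [X in _ + (_ + X) + _]eq_bigr do rewrite -linearB LsP.
  lra.
apply: leeD; last by rewrite lee_fin.
apply: leeD; first exact: xa.
by apply: lee_sum => m _; exact: gu.
Qed.

(** Fenchel-Young inequalities at x bound the dual objective below by minus the
    primal value at x, and all of them are equalities at u. *)
Lemma kkt_argmin_dual :
  argmin (fun v : forall m, U m =>
    conjugate (fun y => f y + (h y)%:E) (- \sum_(m < M) Ls (v m))%R
    + \sum_(m < M) conjugate (@g m) (v m))%E u.
Proof.
have [xa gu _] := xu_kkt; move=> v.
have fhx : (f x + (h x)%:E)%E \is a fin_num by rewrite fin_numD fx.
have xfh : subdifferential (fun y => f y + (h y)%:E)%E x (- \sum_(m < M) Ls (u m)).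
  move=> y; apply: (@le_trans _ _ (f x + (inner (y - x) a)%:E +
      (h x + inner (y - x) (G x))%:E)%E).
    rewrite -(fineK fx) -!EFinD lee_fin GE !innerDr !innerNr; lra.
  by apply: leeD; [exact: xa|rewrite lee_fin].
rewrite (conjugate_subdifferential fhx xfh).
rewrite (eq_bigr (fun m => (inner (L m x) (u m))%:E - g (L m x))%E); last first.
  by move=> m _; exact: conjugate_subdifferential.
apply: (@le_trans _ _ (((inner x (- \sum_(m < M) Ls (v m)))%:E - (f x + (h x)%:E))
  + \sum_(m < M) ((inner (L m x) (v m))%:E - g (L m x)))%E); last first.
  apply: leeD; first exact: fenchel_young.
  by apply: lee_sum => m _; exact: fenchel_young.
have gE (w : forall m, U m) :
    (\sum_(m < M) ((inner (L m x) (w m))%:E - g (L m x)) =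
     (inner x (\sum_(m < M) Ls (w m)) - \sum_(m < M) fine (g (L m x)))%:E)%E.
  rewrite inner_sumr -sumrB -sumEFin; apply: eq_bigr => m _.
  by rewrite -LsP -[in LHS](fineK (gLx m)).
rewrite !gE -(fineK fx) -!EFinD lee_fin !innerNr; lra.
Qed.

End Optimality.

(** * The two forms of the half step *)

Section ProximalSteps.
Context {R : realType} (M : nat) (X : hilbertType R) (U : 'I_M -> hilbertType R).
Variables (f : X -> \bar R) (g : forall m, U m -> \bar R) (G : X -> X).
Variables (L : forall m, {linear X -> U m}) (Ls : forall m, U m -> X).
Hypothesis f_Gamma0 : Gamma0 f.
Hypothesis g_Gamma0 : forall m, Gamma0 (@g m).
Hypothesis LsP : forall m x u, inner (L m x) u = inner x (Ls u).
Variables (x0 a0 : X) (y0 u0 : forall m, U m).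
Hypothesis f_subgradient : subdifferential f x0 a0.
Hypothesis g_subgradient : forall m, subdifferential (@g m) (y0 m) (u0 m).
Variables (tau : R) (sigma : 'I_M -> R).
Hypothesis tau_gt0 : 0 < tau.
Hypothesis sigma_gt0 : forall m, 0 < sigma m.

Lemma prox_scaled_subdifferential w :
  subdifferential f (prox (fun y => tau%:E * f y)%E w)
    (tau^-1 *: (w - prox (fun y => tau%:E * f y)%E w)).
Proof.
apply/subdifferentialZ => //.
apply: (@prox_subdifferential _ _ _ _ x0 (tau *: a0)); first exact: Gamma0Z.
by apply/subdifferentialZ; rewrite // scalerA mulVf ?gt_eqF// scale1r.
Qed.

Let sum_LsB (u v : forall m, U m) : \sum_(m < M) Ls (u m - v m) =
  \sum_(m < M) Ls (u m) - \sum_(m < M) Ls (v m).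
Proof.
rewrite -sumrB; apply: eq_bigr => m _; apply: inner_inj => z.
by rewrite !(innerDr, innerNr) -!LsP !(innerDr, innerNr).
Qed.

Let step := pd_step L Ls tau sigma.
Let A := subdifferential f.
Let B m := subdifferential (@g m).

Lemma form1_step x u t1 t2 :
  t1 = prox (fun y => tau%:E * f y)%E
         (x - tau *: G x - tau *: \sum_(m < M) Ls (u m)) ->
  (forall m, t2 m = prox (fun v => (sigma m)%:E * conjugate (@g m) v)%E
                      (u m + sigma m *: L m (2 *: t1 - x))) ->
  exists a b, step (-1) G A B (x, u) (t1, t2) a b.
Proof.
move=> t1E t2E.
pose w := x - tau *: G x - tau *: \sum_(m < M) Ls (u m).
exists (tau^-1 *: (w - t1)).
exists (fun m => (sigma m)^-1 *: (u m + sigma m *: L m (2 *: t1 - x) - t2 m)).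
split=> /= [|m| |m].
- by rewrite t1E; exact: prox_scaled_subdifferential.
- by rewrite t2E; apply: prox_conjugate_subdifferential => //; exact: g_subgradient.
- rewrite sum_LsB /w; apply: inner_inj => z.
  by rewrite !(innerDr, innerNr, innerZr); field; rewrite gt_eqF.
- rewrite !linearB/= [L m (2 *: t1)]linearZ/=; apply: inner_inj => z.
  by rewrite !(innerDr, innerNr, innerZr); field; rewrite gt_eqF.
Qed.

Lemma form2_step x u t1 t2 :
  (forall m, t2 m = prox (fun v => (sigma m)%:E * conjugate (@g m) v)%E
                      (u m + sigma m *: L m x)) ->
  t1 = prox (fun y => tau%:E * f y)%E
         (x - tau *: G x - tau *: \sum_(m < M) Ls (2 *: t2 m - u m)) ->
  exists a b, step 1 G A B (x, u) (t1, t2) a b.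
Proof.
move=> t2E t1E.
pose w := x - tau *: G x - tau *: \sum_(m < M) Ls (2 *: t2 m - u m).
exists (tau^-1 *: (w - t1)).
exists (fun m => (sigma m)^-1 *: (u m + sigma m *: L m x - t2 m)).
split=> /= [|m| |m].
- by rewrite t1E; exact: prox_scaled_subdifferential.
- by rewrite t2E; apply: prox_conjugate_subdifferential => //; exact: g_subgradient.
- have E : \sum_(m < M) Ls (2 *: t2 m - u m) =
      2 *: \sum_(m < M) Ls (t2 m) - \sum_(m < M) Ls (u m).
    rewrite scaler_sumr -sumrB; apply: eq_bigr => m _; apply: inner_inj => z.
    by rewrite !(innerDr, innerNr, innerZr) -!LsP !(innerDr, innerNr, innerZr).
  rewrite sum_LsB /w E; apply: inner_inj => z.
  by rewrite !(innerDr, innerNr, innerZr); field; rewrite gt_eqF.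
- rewrite !linearB/=; apply: inner_inj => z.
  by rewrite !(innerDr, innerNr, innerZr); field; rewrite gt_eqF.
Qed.

End ProximalSteps.

(** * The convergence theorem *)

Theorem theorem9p6 (R : realType) (M : nat) (M_ge1 : (1 <= M)%N)
    (X : hilbertType R) (U : 'I_M -> hilbertType R)
    (f : X -> \bar R) (f_Gamma0 : Gamma0 f)
    (g : forall m, U m -> \bar R) (g_Gamma0 : forall m, Gamma0 (g m))
    (L : forall m, {linear X -> U m})
    (L_bounded : forall m, bounded_near (L m) (nbhs (0 : X)))
    (h : X -> R^o) (h_convex : convex_function setT h)
    (h_differentiable : forall x, differentiable h x)
    (beta : R) (beta_gt0 : 0 < beta)
    (h_lipschitz : beta.-lipschitz (gradient h))
    (qualification : exists (x p : X) (q : forall m, U m),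
      [/\ subdifferential f x p,
          forall m, subdifferential (g m) (L m x) (q m)
        & 0 = p + \sum_(m < M) adjoint (L m) (q m) + gradient h x])
    (tau : R) (tau_gt0 : 0 < tau)
    (sigma : 'I_M -> R) (sigma_gt0 : forall m, 0 < sigma m)
    (normL : R)
    (normL_def : normL =
      opnorm (fun x : X => \sum_(m < M) sigma m *: adjoint (L m) (L m x)))
    (tau_sigma : tau * (normL + beta / 2) < 1)
    (delta : R) (delta_def : delta = 2 - beta / 2 * (tau^-1 - normL)^-1)
    (rho : nat -> R) (rho_range : forall i, 0 <= rho i <= delta)
    (rho_series :
      (\sum_(0 <= i <oo) (rho i * (delta - rho i))%:E = +oo)%E)
    (x x_half : nat -> X) (u u_half : nat -> forall m, U m)
    (half_step :
      (* form I *)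
      (forall i,
        x_half i = prox (fun y => tau%:E * f y)%E
          (x i - tau *: gradient h (x i)
             - tau *: \sum_(m < M) adjoint (L m) (u i m)) /\
        forall m, u_half i m = prox (fun v => (sigma m)%:E * conjugate (g m) v)%E
          (u i m + sigma m *: L m (2 *: x_half i - x i)))
      \/
      (* form II *)
      (forall i,
        (forall m, u_half i m = prox (fun v => (sigma m)%:E * conjugate (g m) v)%E
          (u i m + sigma m *: L m (x i))) /\
        x_half i = prox (fun y => tau%:E * f y)%E
          (x i - tau *: gradient h (x i)
             - tau *: \sum_(m < M) adjoint (L m) (2 *: u_half i m - u i m))))
    (x_relax : forall i, x i.+1 = x i + rho i *: (x_half i - x i))
    (u_relax : forall i m,
      u i.+1 m = u i m + rho i *: (u_half i m - u i m)) :
  [/\ 1 < delta,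
      exists2 xs : X,
        argmin (fun y => f y + \sum_(m < M) g m (L m y) + (h y)%:E)%E xs
        & weakly_cvg inner x xs
    & exists2 us : forall m, U m,
        argmin (fun v : forall m, U m =>
            conjugate (fun y => f y + (h y)%:E)
              (- \sum_(m < M) adjoint (L m) (v m))%R
            + \sum_(m < M) conjugate (g m) (v m))%E us
        & weakly_cvg sum_inner u us].
Proof.
have [x0 [p0 [q0 [xp0 gq0 kkt0]]]] := qualification.
pose Ls m := adjoint (L m).
have LsP m y v : inner (L m y) v = inner y (Ls m v) by exact: adjointP.
have f_proper : Defs.proper f by case: f_Gamma0.
have g_proper m : Defs.proper (g m) by case: (g_Gamma0 m).
have GP := gradientP h_differentiable.
move: (gradient h) GP h_lipschitz half_step kkt0 => G GP G_lip half_step kkt0.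
have G_coco y z : beta^-1 * inner (G y - G z) (G y - G z) <= inner (y - z) (G y - G z).
  by rewrite -sqrnormE; exact: (baillon_haddad h_differentiable GP).
have h_ge y z : h y + inner (z - y) (G y) <= h z.
  exact: (convex_gradient_le h_differentiable GP).
have normLP y : \sum_(m < M) sigma m * inner (L m y) (L m y) <= normL * inner y y.
  pose A := fun y => \sum_(m < M) sigma m *: Ls m (L m y).
  have AE w z : \sum_(m < M) sigma m * inner (L m w) (L m z) = inner w (A z).
    by rewrite inner_sumr; apply: eq_bigr => m _; rewrite innerZr LsP.
  rewrite AE; apply: (le_trans (inner_le_norm _ _)).
  rewrite inner_norm mulrC expr2 mulrA ler_wpM2r// normL_def.
  (* From |A z|^2 = sum_m sigma_m <L_m (A z), L_m z>. *)
  have [C AC] : exists C, forall z, `|A z| <= C * `|z|.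
    have /all_sig[C CP] m : {C | forall y, `|L m y| <= C * `|y|}.
      by apply: cid; have [C _] := bounded_linear_le (L_bounded m); exists C.
    have C0 m : 0 <= sigma m * C m ^+ 2 by rewrite mulr_ge0 ?sqr_ge0// ltW.
    exists (\sum_(m < M) sigma m * C m ^+ 2) => z.
    have [->|Az0] := eqVneq (A z) 0.
      by rewrite normr0 mulr_ge0// sumr_ge0.
    rewrite -(ler_pM2l (_ : 0 < `|A z|)) ?normr_gt0// -expr2 sqrnormE -AE.
    rewrite mulrCA mulr_suml; apply: ler_sum => m _.
    rewrite -mulrA ler_wpM2l ?(ltW (sigma_gt0 _))//.
    apply: le_trans (inner_le_norm _ _) _.
    by rewrite expr2 mulrACA ler_pM.
  apply: (opnormP (A := A) _ AC) => a z.
  rewrite scaler_sumr; apply: eq_bigr => m _.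
  by rewrite linearZ/= /Ls (adjointZ (L_bounded m)) !scalerA mulrC.
have kappa_beta : beta / 2 < tau^-1 - normL.
  by rewrite ltrBrDr addrC -ltr_pdivlMl// mulr1 in tau_sigma *.
have kappa_gt0 : 0 < tau^-1 - normL by apply: lt_trans kappa_beta; rewrite divr_gt0.
have delta_gt1 : 1 < delta.
  rewrite delta_def ltrBrDl -ltrBrDr (_ : 2 - 1 = 1); last by ring.
  by rewrite ltr_pdivrMr// mul1r.
have [T [eps [eps2 T_step xuT]]] : exists T : X * dprod (fun m => U m : lmodType R) ->
    X * dprod (fun m => U m : lmodType R), exists eps : R,
    [/\ eps ^+ 2 = 1, forall z, exists a b, pd_step L Ls tau sigma eps G
        (subdifferential f) (fun m => subdifferential (g m)) z (T z) a b &
      forall i, T (x i, u i) = (x_half i, u_half i)].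
  case: half_step => half.
  - pose t1 (z : X * dprod (fun m => U m : lmodType R)) :=
      prox (fun y => tau%:E * f y)%E
        (z.1 - tau *: G z.1 - tau *: \sum_(m < M) Ls m (z.2 m)).
    pose t2 (z : X * dprod (fun m => U m : lmodType R)) m :=
      prox (fun v => (sigma m)%:E * conjugate (g m) v)%E
        (z.2 m + sigma m *: L m (2 *: t1 z - z.1)).
    exists (fun z => (t1 z, t2 z)), (-1); split; first by rewrite sqrrN expr1n.
      by move=> [y v]; apply: (form1_step (f_Gamma0) g_Gamma0 LsP xp0 gq0).
    move=> i; have [hx hu] := half i.
    have -> : t1 (x i, u i) = x_half i by rewrite hx.
    by congr (_, _); apply/functional_extensionality_dep => m; rewrite hu hx.
  - pose t2 (z : X * dprod (fun m => U m : lmodType R)) m :=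
      prox (fun v => (sigma m)%:E * conjugate (g m) v)%E
        (z.2 m + sigma m *: L m z.1).
    pose t1 (z : X * dprod (fun m => U m : lmodType R)) :=
      prox (fun y => tau%:E * f y)%E
        (z.1 - tau *: G z.1 - tau *: \sum_(m < M) Ls m (2 *: t2 z m - z.2 m)).
    exists (fun z => (t1 z, t2 z)), 1; split; first by rewrite expr1n.
      by move=> [y v]; apply: (form2_step (f_Gamma0) g_Gamma0 LsP xp0 gq0).
    move=> i; have [hu hx] := half i.
    have t2E : t2 (x i, u i) = u_half i.
      by apply/functional_extensionality_dep => m; rewrite hu.
    by congr (_, _) => //; rewrite hx /t1 t2E.
have A_mono y z b c : subdifferential f y b -> subdifferential f z c ->
    0 <= inner (b - c) (y - z) by exact: subdifferential_monotone.
have B_mono m (y z b c : U m) : subdifferential (g m) y b ->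
    subdifferential (g m) z c -> 0 <= inner (y - z) (b - c).
  by rewrite innerC; exact: subdifferential_monotone.
have kkt_ex : exists y v b, kkt L Ls G (subdifferential f)
    (fun m => subdifferential (g m)) y v b by exists x0, q0, p0; split.
pose z i : X * dprod (fun m => U m : lmodType R) := (x i, u i).
have zS i : z i.+1 = z i - rho i *: (z i - T (z i)).
  rewrite /z xuT x_relax; congr (_, _); first by rewrite -scalerN opprB.
  apply/functional_extensionality_dep => m; rewrite u_relax.
  by rewrite -[u_half i m - _]opprB scalerN.
subst delta.
have pd0 : 0 < pd_delta tau normL beta by rewrite (lt_trans ltr01).
have [l [a kktl] zl] := @pd_converges R M X U L Ls LsP tau sigma normL eps
  sigma_gt0 normLP kappa_gt0 eps2 G beta beta_gt0 G_coco
  (subdifferential f) (fun m => subdifferential (g m)) A_mono B_mono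
  T T_step rho z pd0 kkt_ex rho_range rho_series zS.
split=> //.
- exists l.1; first exact: (kkt_argmin_primal f_proper g_proper h_ge LsP kktl).
  move=> v; have := zl (v, 0); rewrite /sum_inner/=.
  have sum0 (w : forall m, U m) : \sum_(m < M) inner (w m) 0 = 0.
    by rewrite big1// => m _; rewrite inner0r.
  under eq_fun do rewrite sum0 addr0.
  by rewrite sum0 addr0.
- exists l.2; first exact: (kkt_argmin_dual f_proper g_proper h_ge LsP kktl).
  move=> v; have := zl (0, v) => /=.
  under eq_fun do rewrite inner0r add0r.
  by rewrite inner0r add0r.
Qed.
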